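(* Let $p$ be a prime with $p\equiv 1 \pmod 8$. Then the set consisting of $0$ and the nonzero octic residues modulo $p$ is a $(p,k,\lambda,t)$-almost difference set in the additive group of $\mathrm{GF}(p)$ for some $k,\lambda,t$ with $0<t<p-1$ (a ''Type $O_0$'' almost difference set) if and only if $p=41$, or there exist odd integers $t'$ and $u$ such that $p = 8t'^2+1 = 64u^2+9$.
   Context: The nonzero octic residues modulo a prime $p$ are the elements $x^8$ with $x\in \mathrm{GF}(p)^*$. For a finite group $G$ of order $v$ (written additively), a $k$-subset $D$ of $G$ is a $(v,k,\lambda,t)$-almost difference set if exactly $t$ nonzero elements of $G$ occur exactly $\lambda$ times as differences $d-d'$ with $d,d'\in D$, and the other $v-1-t$ nonzero elements occur exactly $\lambda+1$ times. The condition $0<t<v-1$ says that $D$ is not a difference set (a set in which every nonzero element occurs the same number of times as a difference). *)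

(* Defs.v *)
From mathcomp Require Import all_boot all_order all_algebra.

Set Implicit Arguments.
Unset Strict Implicit.
Unset Printing Implicit Defensive.

Import GRing.Theory.
Local Open Scope ring_scope.

Definition difference_count (G : finZmodType) (D : {set G}) (g : G) : nat :=
  #|[set d : G * G | [&& d.1 \in D, d.2 \in D & d.1 - d.2 == g]]|.

(* The remaining nonzero elements number v - 1 - t automatically, since G has
   order v. *)
Definition almost_difference_set (G : finZmodType) (v k lambda t : nat)
    (D : {set G}) : Prop :=
  [/\ #|G| = v,
      #|D| = k,
      #|[set g : G | (g != 0) && (difference_count D g == lambda)]| = t
    & forall g : G, g != 0 -> difference_count D g != lambda ->
        difference_count D g = lambda.+1].

Definition octic_residues (F : finFieldType) : {set F} :=
  [set x ^+ 8 | x : F & x != 0].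

(* Main.v *)
Require Import Defs.
From mathcomp Require Import all_boot all_order all_fingroup all_algebra.
From mathcomp Require Import all_solvable all_field.
From mathcomp Require Import ring zify.

(** Write p = 8 f + 1, let C be the group of octic residues, D its union with
    {0}, chi a character of order 8 with values in the powers of zeta
    (zeta ^+ 4 = -1), gamma a generator with chi gamma = zeta, and N g the
    number of representations of g as a difference in D.  N is constant on the
    cosets gamma ^+ i * C, and D is an almost difference set exactly when N
    takes on nonzero elements exactly two values, which are consecutive.

    Expanding the indicator of C in powers of chi expresses the Fourier
    coefficients sum_i N(gamma ^+ i) * zeta ^+ (i * k) through the Jacobi sums
    J(m, k) of the powers of chi ([octic_class_fourier]).  Classical relations
    ([jacobi_flip], [jacobi_inv], [jacobi_diag], [jacobi_twist]) reduce all
    sums needed, up to the signs chi (-1) = (-1) ^+ f and chi 4 = 1 or -1, to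
    J(2, 4) = a + b i and J(1, 4) = x + y sqrt(-2) and their conjugates, with
    integers satisfying p = a ^+ 2 + b ^+ 2 = x ^+ 2 + 2 y ^+ 2
    ([octic_jacobi_values]).

    If f is even, then D = - D, so N g is odd only when g / 2 lies in D.  Two
    consecutive values then force N to be constant off a single coset, and the
    coefficients k = 1, 2 give b = 0 or p = 7 ^+ 2 + 4 ^+ 2 = 65: impossible
    for a prime ([octic_even_two_valued_not_prime]).

    If f is odd, then -1 lies in gamma ^+ 4 * C, so only four values h0 .. h3 of N
    matter, and the coefficients k = 2, 4 tie h0 - h2, h1 - h3 and
    h0 - h1 + h2 - h3 linearly to a, b, x ([octic_odd_system]).  Two consecutive
    values leave a short list of possibilities ([two_valued_linear]):
    (a, b) = (-5, 4) up to the sign of b gives p = 41, (x, a) = (-1, 3) gives the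
    Pell-type family, and primality and congruences modulo 64 and 9 remove the others.  Conversely p determines a ^+ 2 and
    x ^+ 2 ([quadratic_form_sqr_uniq]), the integrality of the linear relations
    determines the signs and chi 4, and hence the differences of the h_i. *)

Set Implicit Arguments.
Unset Strict Implicit.
Unset Printing Implicit Defensive.

Import Order.TTheory GRing.Theory Num.Theory.
Local Open Scope ring_scope.

(** * Elementary arithmetic *)

Lemma Euclid_dvdzM (p : nat) (m n : int) :
  prime p -> (p%:Z %| m * n)%Z -> (p%:Z %| m)%Z || (p%:Z %| n)%Z.
Proof. by move=> pp; rewrite !dvdzE abszM Euclid_dvdM. Qed.

(** Composition of forms: p ^+ 2 = (a c + s m b d) ^+ 2 + m (a d - s b c) ^+ 2 for
    s = 1 or -1, and p divides a d - s b c for one of these s because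
    p * (d ^+ 2 - b ^+ 2) = (a d) ^+ 2 - (b c) ^+ 2.  As m > 1, the multiple
    a d - s b c of p must vanish. *)
Lemma quadratic_form_sqr_uniq (p : nat) (m a b c d : int) :
  prime p -> 1 < m -> p%:Z = a ^+ 2 + m * b ^+ 2 -> p%:Z = c ^+ 2 + m * d ^+ 2 ->
  a ^+ 2 = c ^+ 2.
Proof.
move=> pp m1 Eab Ecd; have p0 : 0 < p%:Z by rewrite ltz_nat prime_gt0.
have key (s : int) : s ^+ 2 = 1 -> (p%:Z %| a * d - s * (b * c))%Z -> a ^+ 2 = c ^+ 2.
  move=> s2 /dvdzP[k Ek].
  have E : p%:Z ^+ 2 = (a * c + s * m * (b * d)) ^+ 2 + m * (k * p%:Z) ^+ 2.
    rewrite -Ek.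
    transitivity (a ^+ 2 * c ^+ 2 + s ^+ 2 * m ^+ 2 * b ^+ 2 * d ^+ 2 + m * a ^+ 2 * d ^+ 2 + s ^+ 2 * m * b ^+ 2 * c ^+ 2); last by ring.
    by rewrite s2 expr2 {1}Eab Ecd; ring.
  have k0 : k = 0.
    have [//|kn0] := eqVneq k 0.
    have k1 : 0 < k ^+ 2 by rewrite exprn_even_gt0.
    have mk : 1 < m * k ^+ 2 by apply: (lt_le_trans m1); rewrite ler_peMr -?gtz0_ge1 // (le_trans _ (ltW m1)).
    have : p%:Z ^+ 2 < m * (k * p%:Z) ^+ 2.
      rewrite exprMn mulrA -[X in X < _]mul1r ltr_pM2r // exprn_gt0 //.
    by rewrite {1}E -subr_gt0 opprD addrCA subrr addr0 oppr_gt0 ltNge sqr_ge0.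
  have Ek' : a * d = s * (b * c) by move: Ek; rewrite k0 mul0r => /eqP; rewrite subr_eq0 => /eqP.
  apply: (mulIf (lt0r_neq0 p0)).
  rewrite {1}Ecd Eab.
  transitivity (a ^+ 2 * c ^+ 2 + m * (a * d) ^+ 2); first by ring.
  by rewrite Ek' exprMn s2; ring.
have: (p%:Z %| (a * d - 1 * (b * c)) * (a * d - - 1 * (b * c)))%Z.
  apply/dvdzP; exists (d ^+ 2 - b ^+ 2).
  transitivity (d ^+ 2 * (a ^+ 2 + m * b ^+ 2) - b ^+ 2 * (c ^+ 2 + m * d ^+ 2)); first by ring.
  by rewrite -Eab -Ecd; ring.
by case/(Euclid_dvdzM pp)/orP; apply: key; rewrite ?sqrrN expr1n.
Qed.

Lemma parityz (n : int) : exists k, n = 2 * k \/ n = 2 * k + 1.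
Proof. by exists (n %/ 2)%Z; lia. Qed.

Lemma mod3z (n : int) : exists k, n = 3 * k \/ n = 3 * k + 1 \/ n = 3 * k + 2.
Proof. by exists (n %/ 3)%Z; lia. Qed.

Lemma sqr_even (y m : int) : y ^+ 2 = 4 * m -> exists2 z, y = 2 * z & z ^+ 2 = m.
Proof.
case: (parityz y) => k [] -> E; first by exists k => //; lia.
have : 4 * (k ^+ 2 + k) + 1 = 4 * m by rewrite -E; ring.
by lia.
Qed.

Lemma sqr_odd (k : int) : exists j, (2 * k + 1) ^+ 2 = 8 * j + 1.
Proof.
case: (parityz k) => l [] ->.
  by exists (2 * l ^+ 2 + l); ring.
by exists (2 * l ^+ 2 + 3 * l + 1); ring.
Qed.

Lemma sqr_mod64 (b k : int) : b ^+ 2 <> 64 * k + 32.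
Proof.
have -> : 64 * k + 32 = 4 * (4 * (4 * k + 2)) by ring.
case/sqr_even=> c _ /sqr_even[d _]; case: (parityz d) => l [] -> E.
  have : 4 * l ^+ 2 = 4 * k + 2 by rewrite -E; ring.
  by lia.
have : 4 * (l ^+ 2 + l) + 1 = 4 * k + 2 by rewrite -E; ring.
by lia.
Qed.

Lemma prime_not_square (p : nat) (a : int) : prime p -> p%:Z <> a ^+ 2.
Proof.
move=> pp E; have {}E : p = (`|a| ^ 2)%N by rewrite -abszX -E.
have p1 := prime_gt1 pp; have /primeP[_ /(_ `|a|%N)] := pp.
rewrite E dvdn_exp // => /(_ isT) /orP[] /eqP a1; move: p1; rewrite E.
  by rewrite a1.
by move: a1; rewrite -mulnn; nia.
Qed.

Lemma prime_not_mul9 (p : nat) (k : int) : prime p -> p%:Z <> 9 * k.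
Proof.
move=> pp E; have E9 : p = (9 * `|k|)%N by lia.
have := dvdn_mulr `|k| (isT : 3 %| 9)%N; rewrite -E9 dvdn_prime2 // => /eqP p3.
by move: E9; rewrite -p3; lia.
Qed.

(** -1 is not a square modulo 3. *)
Lemma sqr_add_mul3 (a b k : int) : a ^+ 2 + b ^+ 2 = 3 * k ->
  (exists a', a = 3 * a') /\ (exists b', b = 3 * b').
Proof.
have [q a3] := mod3z a; have [r b3] := mod3z b => E.
have sq (n i j : int) : n = 3 * i + j -> exists l, n ^+ 2 = 3 * l + j ^+ 2.
  by move=> ->; exists (3 * i ^+ 2 + 2 * i * j); ring.
have {}a3 : a = 3 * q \/ exists l, a ^+ 2 = 3 * l + 1.
  case: a3 => [E'|[/sq[l El]|/sq[l El]]]; first by left.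
    by right; exists l; rewrite El; ring.
  by right; exists (l + 1); rewrite El; ring.
have {}b3 : b = 3 * r \/ exists l, b ^+ 2 = 3 * l + 1.
  case: b3 => [E'|[/sq[l El]|/sq[l El]]]; first by left.
    by right; exists l; rewrite El; ring.
  by right; exists (l + 1); rewrite El; ring.
move: E; case: a3 => [Ea|[l El]]; case: b3 => [Eb|[l' El']].
- by split; [exists q|exists r].
- by rewrite El' Ea exprMn; lia.
- by rewrite El Eb exprMn; lia.
- by rewrite El El'; lia.
Qed.

(** The square root of m is explicit:
    gcd(m, w) ^+ 2 = gcd(m ^+ 2, m w, w ^+ 2) = m * gcd(m, w, n) = m. *)
Lemma coprime_mul_sqr (m n w : nat) : coprime m n -> (m * n = w ^ 2)%N ->
  m = (gcdn m w ^ 2)%N.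
Proof.
move=> cmn E; set g := gcdn m w.
have Ew : (g * w = m * gcdn w n)%N by rewrite /g muln_gcdl muln_gcdr mulnn -E [(m * w)%N]mulnC.
have -> : (g ^ 2 = m * gcdn g (gcdn w n))%N.
  by rewrite muln_gcdr -Ew [(m * g)%N]mulnC -muln_gcdr -mulnn.
have /eqP -> : gcdn g (gcdn w n) == 1%N; last by rewrite muln1.
rewrite -dvdn1 -(eqP cmn) dvdn_gcd.
rewrite (dvdn_trans (dvdn_gcdl _ _)) ?dvdn_gcdl //=.
by rewrite (dvdn_trans (dvdn_gcdr _ _)) ?dvdn_gcdr.
Qed.

Lemma sqr_mod3 s : (s ^ 2 %% 3 = (s %% 3 != 0%N))%N.
Proof.
rewrite -mulnn -modnMm; have := ltn_pmod s (isT : 0 < 3)%N.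
by case: (s %% 3)%N => [|[|[|]]].
Qed.

Lemma sqr_mod8 s : (s ^ 2 %% 8 != 7)%N.
Proof.
rewrite -mulnn -modnMm; have := ltn_pmod s (isT : 0 < 8)%N.
by case: (s %% 8)%N => [|[|[|[|[|[|[|[|]]]]]]]].
Qed.

(** If 3 does not divide w, then m (m + 1) is 2 modulo 3, so m is 1 and m + 1 is
    2 modulo 3.  Of the coprime numbers m and m + 1, one is 8 times a square
    and the other a square; the square would be either m + 1, which is 2
    modulo 3, or m, which is 7 modulo 8. *)
Lemma pronic_eq_8sqr (m w : nat) : (m * m.+1 = 8 * w ^ 2)%N -> (3 %| w)%N.
Proof.
move=> E; apply/negPn/negP => w3.
have m1 : (m %% 3 = 1)%N.
  have := congr1 (modn^~ 3) E; rewrite -modnMm -[in RHS]modnMm sqr_mod3 -[_ != 0%N]/(~~ (3 %| w)%N) w3.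
  rewrite -[m.+1]addn1 -modnDml; have := ltn_pmod m (isT : 0 < 3)%N.
  by case: (m %% 3)%N => [|[|[|]]].
have cm : coprime m m.+1 by rewrite coprimenS.
have m8 : (8 %| m * m.+1)%N by rewrite E dvdn_mulr.
have [om|em] := boolP (odd m).
  have : (8 %| m.+1)%N by rewrite -(@Gauss_dvdr 8 m) // (@coprimeXl 3 2) // coprime2n.
  case/dvdnP=> n En.
  have Ew : (m * n = w ^ 2)%N by apply/eqP; rewrite -(eqn_pmul2l (isT : 0 < 8)%N) -E En; apply/eqP; ring.
  have cmn : coprime m n by apply: coprime_dvdr cm; rewrite En dvdn_mulr.
  have := sqr_mod8 (gcdn m w); rewrite -(coprime_mul_sqr cmn Ew); lia.
have : (8 %| m)%N by rewrite -(@Gauss_dvdl 8 m m.+1) // (@coprimeXl 3 2) // coprime2n /= em.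
case/dvdnP=> n En.
have Ew : (m.+1 * n = w ^ 2)%N by apply/eqP; rewrite -(eqn_pmul2l (isT : 0 < 8)%N) -E {2}En; apply/eqP; ring.
have cmn : coprime m.+1 n by rewrite coprime_sym; apply: coprime_dvdl cm; rewrite En dvdn_mulr.
have := sqr_mod3 (gcdn m.+1 w); rewrite -(coprime_mul_sqr cmn Ew) -[m.+1]addn1 -modnDml m1.
by case: (_ != _).
Qed.

(** Writing t = 2 m + 1, the relation t ^+ 2 = 8 (2 w) ^+ 2 + 1 becomes
    m (m + 1) = 8 w ^+ 2, so that 3 divides w and 9 divides p.  This makes u odd
    in p = 64 u ^+ 2 + 9. *)
Lemma pell_odd (p : nat) (t w : int) : prime p -> p%:Z = 8 * t ^+ 2 + 1 ->
  p%:Z <> 64 * (2 * w) ^+ 2 + 9.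
Proof.
move=> pp Et Eu.
have tw : t ^+ 2 = 8 * (2 * w) ^+ 2 + 1 by lia.
have Etn : (`|t| ^ 2 = 32 * `|w| ^ 2 + 1)%N.
  by apply/eqP; rewrite -eqz_nat -!abszX; move: tw (sqr_ge0 t) (sqr_ge0 w); rewrite exprMn; lia.
have ot : odd `|t| by have := congr1 odd Etn; rewrite oddX oddD oddM.
pose m := (`|t|./2)%N.
have Em : `|t|%N = m.*2.+1 by rewrite -(odd_double_half `|t|) ot.
have : (m * m.+1 = 8 * `|w| ^ 2)%N.
  apply/eqP; rewrite -(eqn_pmul2l (isT : 0 < 4)%N) -(eqn_add2r 1); apply/eqP.
  transitivity (`|t| ^ 2)%N; last by rewrite Etn; ring.
  by rewrite Em -addnn; ring.
case/pronic_eq_8sqr/dvdnP => k Ek.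
apply: (@prime_not_mul9 p (64 * 4 * k%:Z ^+ 2 + 1) pp); rewrite Eu.
have : w ^+ 2 = 9 * k%:Z ^+ 2.
  have := sqr_ge0 w; have : (`|w ^+ 2| = 9 * k ^ 2)%N by rewrite abszX Ek; ring.
  by lia.
by rewrite exprMn => ->; ring.
Qed.

(** * Multiplicative characters and Jacobi sums *)

Section MultiplicativeCharacters.

Variables (F : finFieldType) (L : numFieldType).
Implicit Types (A B C : F -> L) (x y t : F).

(** The convention A 0 = 0, kept for the trivial character as well, lets Jacobi sums
    run over the whole field. *)
Record mult_char A : Prop := MultChar {
  mult_char0 : A 0 = 0;
  mult_char1 : A 1 = 1;
  mult_charM : forall x y, A (x * y) = A x * A y
}.

Lemma mult_charX A n : (0 < n)%N -> mult_char A -> mult_char (fun x => A x ^+ n).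
Proof.
move=> n0 [A0 A1 AM]; split=> [||x y]; rewrite ?A0 ?A1 ?AM ?expr1n ?exprMn //.
by rewrite expr0n eqn0Ngt n0.
Qed.

Lemma mult_char_prod A B : mult_char A -> mult_char B -> mult_char (fun x => A x * B x).
Proof.
case=> A0 A1 AM [B0 B1 BM].
by split=> [||x y]; rewrite ?A0 ?A1 ?AM ?B1 ?BM ?mul0r ?mulr1 // mulrACA.
Qed.

Lemma mult_charV A x : mult_char A -> A x^-1 = (A x)^-1.
Proof.
move=> [A0 A1 AM]; have [->|x0] := eqVneq x 0; first by rewrite invr0 A0 invr0.
have E : A x * A x^-1 = 1 by rewrite -AM mulfV.
have Ax : A x != 0 by apply/eqP => A0x; move/eqP: E; rewrite A0x mul0r eq_sym oner_eq0.
by apply: (mulfI Ax); rewrite E mulfV.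
Qed.

Lemma mult_char_neq0 A x : mult_char A -> x != 0 -> A x != 0.
Proof.
move=> [A0 A1 AM] x0; have E : A x * A x^-1 = 1 by rewrite -AM mulfV.
by apply/eqP => A0x; move/eqP: E; rewrite A0x mul0r eq_sym oner_eq0.
Qed.

Lemma sum_mult_char A y : mult_char A -> y != 0 -> A y != 1 -> \sum_x A x = 0.
Proof.
move=> hA y0 Ay; have E : \sum_x A x = A y * \sum_x A x.
  rewrite mulr_sumr (reindex_inj (mulfI y0)) /=.
  by apply: eq_bigr => x _; rewrite mult_charM.
move/eqP: E; rewrite -subr_eq0 -{1}[\sum_x A x]mul1r -mulrBl mulf_eq0 subr_eq0 eq_sym.
by rewrite (negbTE Ay) => /eqP.
Qed.

Definition jacobi A B : L := \sum_t A t * B (1 - t).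

Lemma jacobiC A B : jacobi A B = jacobi B A.
Proof.
rewrite /jacobi (reindex_inj (inv_inj (subKr 1))) /=.
by apply: eq_bigr => t _; rewrite subKr mulrC.
Qed.

(** The substitution t |-> - t / (1 - t), an involution of F minus {1}, turns 1 - t
    into its inverse. *)
Lemma jacobi_flip A B C : mult_char A -> mult_char B -> mult_char C ->
  (forall x, x != 0 -> A x * B x * C x = 1) ->
  jacobi A B = A (-1) * jacobi A C.
Proof.
move=> hA hB hC ABC; rewrite /jacobi mulr_sumr.
rewrite (bigD1 1) //= [RHS](bigD1 1) //= subrr !mult_char0 // !mulr0 !add0r.
pose h t : F := - (t / (1 - t)).
have h1 t : t != 1 -> 1 - h t = (1 - t)^-1.
  move=> t1; rewrite /h opprK; have : 1 - t != 0 by rewrite subr_eq0 eq_sym.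
  by move=> ?; field.
have hK t : t != 1 -> h (h t) = t.
  move=> t1; rewrite {1}/h h1 // invrK /h mulNr opprK divfK //.
  by rewrite subr_eq0 eq_sym.
rewrite (reindex_onto h h) //=; apply: eq_big => [t|t /andP[]].
  have [->|t1] := eqVneq t 1; first by rewrite /h subrr invr0 mulr0 oppr0 mul0r oppr0 (eq_sym 0) oner_eq0 andbF.
  rewrite hK // eqxx andbT; apply/negP => /eqP ht.
  have := h1 _ t1; rewrite ht subrr => /eqP; rewrite eq_sym invr_eq0 subr_eq0.
  by rewrite eq_sym (negbTE t1).
have [->|t1 _ _] := eqVneq t 1; first by rewrite /h subrr invr0 mulr0 oppr0 mul0r oppr0 (eq_sym 0) oner_eq0.
have u0 : 1 - t != 0 by rewrite subr_eq0 eq_sym.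
rewrite h1 // /h -[- (_ / _)]mulN1r !(mult_charM hA) -!mulrA; congr (_ * (_ * _)).
have v0 : (1 - t)^-1 != 0 by rewrite invr_eq0.
have := ABC _ v0; rewrite [C _]mult_charV // => /(canRL (mulfVK _)) ->; first by rewrite mul1r.
exact: mult_char_neq0.
Qed.

Definition trivial_char x : L := (x != 0)%:R.

Lemma trivial_charP : mult_char trivial_char.
Proof.
split=> [||x y]; rewrite /trivial_char ?eqxx ?oner_eq0 //.
by rewrite mulf_eq0 negb_or -mulnb natrM.
Qed.

Lemma jacobi_trivial A y : mult_char A -> y != 0 -> A y != 1 ->
  jacobi A trivial_char = -1.
Proof.
move=> hA y0 Ay; have := sum_mult_char hA y0 Ay.
rewrite /jacobi (bigD1 1) //= mult_char1 // => /eqP; rewrite addr_eq0 => /eqP ->.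
rewrite opprK (bigD1 1) //= /trivial_char subrr eqxx mulr0 add0r.
by apply: eq_bigr => t t1; rewrite subr_eq0 eq_sym t1 mulr1.
Qed.

Lemma jacobi_inv A B y : mult_char A -> mult_char B -> y != 0 -> A y != 1 ->
  (forall x, x != 0 -> A x * B x = 1) -> jacobi A B = - A (-1).
Proof.
move=> hA hB y0 Ay AB; rewrite (jacobi_flip hA hB trivial_charP).
  by rewrite (jacobi_trivial hA y0 Ay) mulrN1.
by move=> x x0; rewrite AB // /trivial_char x0 mulr1.
Qed.

(** With s = u t the product is a double sum over u and t.  For fixed u <> 0, 1
    the ratio (1 - u t) / (1 - t) takes every value but u once as t runs over F
    minus {1}, so the inner sum is - B u, and u = 1 contributes the main term. *)
Lemma jacobi_norm A B A' B' y z w : mult_char A -> mult_char B ->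
  mult_char A' -> mult_char B' ->
  (forall x, x != 0 -> A x * A' x = 1) -> (forall x, x != 0 -> B x * B' x = 1) ->
  y != 0 -> A y != 1 -> z != 0 -> B z != 1 -> w != 0 -> A w * B w != 1 ->
  jacobi A B * jacobi A' B' = #|F|%:R.
Proof.
move=> hA hB hA' hB' AA BB y0 Ay z0 Bz w0 ABw.
have inner u : u != 0 -> \sum_t B (1 - u * t) * B' (1 - t) = #|F|%:R *+ (u == 1) - B u.
  move=> u0; have [->|u1] := eqVneq u 1.
    rewrite mulr1n mult_char1 // (bigD1 1) //= mul1r subrr !mult_char0 // mul0r add0r.
    under eq_bigr => t t1 do rewrite mul1r BB ?subr_eq0 1?eq_sym //.
    rewrite sumr_const cardC1 -subn1 natrB //.
    by apply/card_gt0P; exists 0.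
  rewrite mulr0n add0r (reindex_inj (inv_inj (subKr 1))) /=.
  rewrite (bigD1 0) //= subKr mult_char0 // mulr0 add0r.
  rewrite (eq_bigr (fun v => B ((1 - u) * v^-1 + u))) => [|v v0]; last first.
    rewrite subKr.
    have -> : (1 - u) * v^-1 + u = (1 - u * (1 - v)) * v^-1 by field.
    by rewrite mult_charM // mult_charV // -[(B v)^-1]mulr1 -(BB v) // mulKf // mult_char_neq0.
  have u1' : 1 - u != 0 by rewrite subr_eq0 eq_sym.
  have := sum_mult_char hB z0 Bz.
  pose g v : F := (1 - u) * v^-1 + u.
  have g_inj : injective g by move=> v v' /addIr /(mulfI u1') /invr_inj.
  rewrite (reindex_inj g_inj) (bigD1 0) //= {1}/g invr0 mulr0 add0r addrC.
  by move/eqP; rewrite addr_eq0 => /eqP.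
have -> : jacobi A B * jacobi A' B' =
    \sum_u A u * (#|F|%:R *+ (u == 1) - B u - 1).
  rewrite [jacobi A' B']/jacobi mulr_sumr (bigD1 0) //= mult_char0 // mul0r mulr0 add0r.
  transitivity (\sum_(t | t != 0) \sum_u A u * (B (1 - u * t) * B' (1 - t))).
    apply: eq_bigr => t t0; rewrite /jacobi mulr_suml (reindex_inj (mulIf t0)) /=.
    apply: eq_bigr => u _; rewrite mult_charM //.
    by rewrite -[in RHS](mulr1 (A u)) -(AA _ t0); ring.
  rewrite exchange_big /=; apply: eq_bigr => u _; rewrite -mulr_sumr.
  have [->|u0] := eqVneq u 0; first by rewrite mult_char0 // !mul0r.
  by rewrite -inner // [in RHS](bigD1 0) //= mulr0 !subr0 !mult_char1 // mulr1 [1 + _]addrC addrK.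
under eq_bigr do rewrite mulrBr mulrBr mulr1.
rewrite !sumrB (sum_mult_char hA y0 Ay) (sum_mult_char (mult_char_prod hA hB) w0 ABw) !subr0.
rewrite (bigD1 1) //= eqxx mulr1n mult_char1 // mul1r big1 ?addr0 // => u /negbTE ->.
by rewrite mulr0n mulr0.
Qed.

End MultiplicativeCharacters.

(** * Jacobi sums and the quadratic character *)

Section QuadraticCharacter.

Variables (F : finFieldType) (L : numFieldType).
Variables (A rho : F -> L).
Hypotheses (hA : mult_char A) (hrho : mult_char rho) (two_neq0 : 2 != 0 :> F).
Hypothesis rho_sqr : forall x : F, x != 0 -> rho x ^+ 2 = 1.
Hypothesis rho_count : forall y : F, \sum_x (x ^+ 2 == y)%:R = 1 + rho y.

Let reidx_inj : injective (fun s : F => (1 - s) / 2).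
Proof.
move=> s t /= /(mulIf _) E; apply: oppr_inj; apply: (addrI 1); apply: E.
by rewrite invr_eq0.
Qed.

Lemma sum_over_squares (G : F -> L) : \sum_s G (s ^+ 2) = \sum_y G y * (1 + rho y).
Proof.
transitivity (\sum_s \sum_y G y * (s ^+ 2 == y)%:R).
  apply: eq_bigr => s _; rewrite (bigD1 (s ^+ 2)) //= eqxx mulr1 big1 ?addr0 //.
  by move=> y /negbTE; rewrite eq_sym => ->; rewrite mulr0.
rewrite exchange_big /=; apply: eq_bigr => y _.
by rewrite -mulr_sumr rho_count.
Qed.

(** With t = (1 - s) / 2 one has 4 t (1 - t) = 1 - s ^+ 2, and summing over squares
    is summing against 1 + rho. *)
Lemma jacobi_diag y : y != 0 -> A y != 1 -> A 4 * jacobi A A = jacobi A rho.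
Proof.
move=> y0 Ay; rewrite /jacobi (reindex_inj reidx_inj) mulr_sumr /=.
transitivity (\sum_s A (1 - s ^+ 2)).
  by apply: eq_bigr => s _; rewrite -!(mult_charM hA); congr A; field.
rewrite (sum_over_squares (fun u => A (1 - u))) /=.
rewrite (eq_bigr (fun u => A (1 - u) + A (1 - u) * rho u)); last first.
  by move=> u _; rewrite mulrDr mulr1.
rewrite big_split /= (reindex_inj (inv_inj (subKr 1))) /=.
under eq_bigr do rewrite subKr.
rewrite (sum_mult_char hA y0 Ay) add0r -[RHS]/(jacobi A rho) jacobiC.
by apply: eq_bigr => s _; rewrite mulrC.
Qed.

Let circle (s r : F) : L := (s ^+ 2 + r ^+ 2 == 1)%:R.

Let circleC s r : circle s r = circle r s.
Proof. by rewrite /circle addrC. Qed.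

Let sum_circle s : \sum_r circle s r = 1 + rho (1 - s ^+ 2).
Proof.
rewrite -rho_count; apply: eq_bigr => r _; congr (_%:R).
by rewrite /circle [in RHS]eq_sym subr_eq eq_sym addrC.
Qed.

Let rhoM1 s : s != -1 -> rho (1 + s) * (1 + rho (1 - s ^+ 2)) = rho (1 + s) + rho (1 - s).
Proof.
move=> s1; have s1' : 1 + s != 0 by rewrite addrC addr_eq0.
have -> : 1 - s ^+ 2 = (1 + s) * (1 - s) by ring.
by rewrite (mult_charM hrho) mulrDr mulr1 mulrA -expr2 rho_sqr // mul1r.
Qed.

(** On the circle, 2 (1 + s) (1 + r) = (1 + s + r) ^+ 2. *)
Let rho_swap s r : s ^+ 2 + r ^+ 2 = 1 -> 1 + s != 0 -> 1 + r != 0 ->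
  rho (1 + s) = rho 2 * rho (1 + r).
Proof.
move=> E s1 r1.
have E2 : 2 * ((1 + s) * (1 + r)) = (1 + s + r) * (1 + s + r).
  by apply/eqP; rewrite -subr_eq0 -(subrr (s ^+ 2 + r ^+ 2)) {1}E; apply/eqP; ring.
have n0 : 1 + s + r != 0.
  apply/eqP => H; move/eqP: E2; rewrite H mul0r !mulf_eq0.
  by rewrite (negbTE two_neq0) (negbTE s1) (negbTE r1).
have := congr1 rho E2; rewrite !(mult_charM hrho) -[X in _ = X]expr2 rho_sqr // => H.
have := rho_sqr s1; move: H; set a := rho 2; set b := rho (1 + s); set c := rho (1 + r).
move=> abc b2; have : b * b * (a * c) = b by rewrite -[RHS]mulr1 -abc; ring.
by rewrite -expr2 b2 mul1r.
Qed.

Let rho2_sqr : rho 2 * rho 2 = 1.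
Proof. by rewrite -expr2 rho_sqr. Qed.

(** The Hasse-Davenport relation for the pair A, A rho.  After t = (1 - s) / 2 the
    left side becomes rho 2 times T, the sum of A (1 - s ^+ 2) * rho (1 + s).
    Summing A (r ^+ 2) * rho (1 + s) over the circle s ^+ 2 + r ^+ 2 = 1 gives 2 T;
    by [rho_swap] the factor rho (1 + s) may be traded for rho 2 * rho (1 + r), and
    the sum of A (r ^+ 2) * rho (1 + r) is 2 J - rho 2, J being the right side. *)
Lemma jacobi_twist :
  A 4 * jacobi A (fun x => A x * rho x) = jacobi (fun x => A x ^+ 2) rho.
Proof.
pose T := \sum_s A (1 - s ^+ 2) * rho (1 + s).
have -> : A 4 * jacobi A (fun x => A x * rho x) = rho 2 * T.
  rewrite /jacobi (reindex_inj reidx_inj) mulr_sumr /T mulr_sumr /=.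
  apply: eq_bigr => s _.
  have -> : 1 - (1 - s) / 2 = (1 + s) / 2 by field.
  have -> : 1 - s ^+ 2 = 4 * ((1 - s) / 2) * ((1 + s) / 2) by field.
  have E : rho 2 * rho (2^-1) = 1 by rewrite -(mult_charM hrho) mulfV // mult_char1.
  rewrite !(mult_charM hA) (mult_charM hrho (1 + s)).
  have -> : rho 2^-1 = rho 2 by rewrite -[LHS]mul1r -rho2_sqr -mulrA E mulr1.
  ring.
set J := jacobi _ _.
have V1 : \sum_s \sum_r circle s r * (A (r ^+ 2) * rho (1 + s)) = T + T.
  have Tn : T = \sum_s A (1 - s ^+ 2) * rho (1 - s).
    by rewrite /T (reindex_inj oppr_inj); apply: eq_bigr => s _; rewrite sqrrN.
  rewrite {2}Tn /T -big_split /=; apply: eq_bigr => s _.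
  transitivity (\sum_r circle s r * (A (1 - s ^+ 2) * rho (1 + s))).
    apply: eq_bigr => r _; rewrite /circle.
    have [E|_] := eqVneq (s ^+ 2 + r ^+ 2) 1; last by rewrite mulr0n !mul0r.
    by have -> : 1 - s ^+ 2 = r ^+ 2 by rewrite -E [s ^+ 2 + _]addrC addrK.
  rewrite -mulr_suml sum_circle.
  have [->|s1] := eqVneq s (-1).
    by rewrite sqrrN expr1n subrr (mult_char0 hA) !mul0r mulr0 addr0.
  by rewrite -mulrDr -rhoM1 //; ring.
have V2 : \sum_r \sum_s circle r s * (A (r ^+ 2) * rho (1 + r)) = J + J - rho 2.
  have Jn : J = \sum_r A (r ^+ 2) * rho (1 + r).
    rewrite /J /jacobi (reindex_inj oppr_inj); apply: eq_bigr => r _.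
    by rewrite opprK expr2 -(mult_charM hA) -expr2 sqrrN.
  rewrite {2}Jn /J /jacobi -big_split /=.
  transitivity (\sum_r (A r ^+ 2 * rho (1 - r) + A (r ^+ 2) * rho (1 + r) - (r == -1)%:R * rho 2)).
    apply: eq_bigr => r _; rewrite -mulr_suml sum_circle.
    have -> : A r ^+ 2 = A (r ^+ 2) by rewrite expr2 -(mult_charM hA).
    have [->|r1] := eqVneq r (-1).
      have -> : 1 - -1 = 2 :> F by rewrite opprK.
      by rewrite subrr (mult_char0 hrho) !mulr0 sqrrN expr1n (mult_char1 hA) !mul1r addr0 subrr.
    by rewrite mul0r subr0 -mulrDr [rho (1 - r) + _]addrC -rhoM1 //; ring.
  rewrite sumrB; congr (_ - _).
  by rewrite (bigD1 (-1)) //= eqxx mul1r big1 ?addr0 // => r /negbTE ->; rewrite mul0r.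
(* (0, -1) is the only point of the circle where the trade fails with nonzero weight *)
have V3 : \sum_s \sum_r circle s r * (A (r ^+ 2) * rho (1 + s)) =
    rho 2 * (\sum_r \sum_s circle r s * (A (r ^+ 2) * rho (1 + r))) + 1.
  have <- : \sum_(s : F) \sum_(r : F) ((s == 0) && (r == -1))%:R = 1 :> L.
    rewrite (bigD1 0) //= [X in _ + X]big1 ?addr0 => [|s /negbTE s0]; last first.
      by rewrite s0 big1.
    rewrite eqxx /= (bigD1 (-1)) //= eqxx big1 ?addr0 // => r /negbTE ->; exact: erefl.
  rewrite [in RHS]exchange_big /=.
  rewrite mulr_sumr -big_split; apply: eq_bigr => s _.
  rewrite mulr_sumr -big_split; apply: eq_bigr => r _ /=.
  rewrite [circle r s]circleC /circle.
  have [E|nE] := eqVneq (s ^+ 2 + r ^+ 2) 1; last first.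
    rewrite mulr0n !mul0r mulr0 add0r; case: eqP => // s0; case: eqP => // r1.
    by case/eqP: nE; rewrite s0 r1 sqrrN expr1n expr0n add0r.
  rewrite !mul1r.
  have [s1|s1] := eqVneq (1 + s) 0.
    have s1' : s = -1 by apply/eqP; rewrite -addr_eq0 addrC s1.
    have r0 : r ^+ 2 = 0 by apply: (addrI 1); rewrite addr0 -[RHS]E s1' sqrrN expr1n.
    rewrite r0 (mult_char0 hA) !mul0r mulr0 add0r s1' oppr_eq0 oner_eq0 //.
  have [r1|r1] := eqVneq (1 + r) 0.
    have r1' : r = -1 by apply/eqP; rewrite -addr_eq0 addrC r1.
    have /eqP : s ^+ 2 = 0 by apply: (addIr 1); rewrite add0r -[RHS]E r1' sqrrN expr1n.
    rewrite sqrf_eq0 => /eqP ->; rewrite r1' sqrrN expr1n subrr (mult_char0 hrho) !eqxx.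
    by rewrite !mulr0 addr0 (mult_char1 hA) (mult_char1 hrho) add0r mul1r.
  have -> : (r == -1) = false by rewrite -addr_eq0 addrC; apply: negbTE.
  by rewrite andbF addr0 (rho_swap E) // mulrCA.
have two0 : 2 != 0 :> L by rewrite pnatr_eq0.
apply: (mulfI two0); move: V3; rewrite V1 V2 mulrBr rho2_sqr subrK => TT.
by rewrite mulrCA mulr2n mulrDl mul1r TT mulrA rho2_sqr mulrDl !mul1r.
Qed.
End QuadraticCharacter.

(** * Octic characters *)

(** The data carried by a field of 8 f + 1 elements: a generator gamma and the
    character of order 8 sending it to zeta.  The number f enters only through the
    position of -1 among the powers of gamma. *)
Record octic_char (F : finFieldType) (L : numFieldType) (f : nat) (zeta : L)
    (chi : F -> L) (gamma : F) : Prop := OcticChar {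
  octic_zeta : zeta ^+ 4 = -1;
  octic_mult : mult_char chi;
  octic_gen : chi gamma = zeta;
  octic_genP : forall x, x != 0 -> exists n, x = gamma ^+ n;
  octic_half : gamma ^+ (4 * f) = -1;
  octic_two : 2 != 0 :> F
}.

Lemma octic_char_exists (F : finFieldType) (L : numFieldType) f (zeta : L) :
  #|F| = (8 * f).+1 -> zeta ^+ 4 = -1 -> exists chi gamma, @octic_char F L f zeta chi gamma.
Proof.
move=> cF z4.
have z8 : zeta ^+ 8 = 1 by rewrite (exprM zeta 4 2) z4 sqrrN expr1n.
have /cyclicP[g Eg] := field_unit_group_cyclic [set: {unit F}]%G.
have og : #[g]%g = (8 * f)%N by rewrite orderE -Eg card_finField_unit cF.
pose gamma : F := val g.
have g0 : gamma != 0 by rewrite -unitfE (valP g).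
have gX n : gamma ^+ n = val (g ^+ n)%g by rewrite FinRing.val_unitX.
have gE m n : gamma ^+ m = gamma ^+ n -> m = n %[mod 8 * f].
  by rewrite !gX => /val_inj /eqP; rewrite eq_expg_mod_order og => /eqP.
have gP (x : F) : exists n, (x != 0) ==> (x == gamma ^+ n).
  have [_|] := eqVneq x 0; first by exists 0%N.
  rewrite -unitfE => ux; have : (FinRing.Unit ux : {unit F}) \in <[g]>%g by rewrite -Eg inE.
  by case/cycleP=> n En; exists n; rewrite gX -En /= eqxx.
pose dlog x := xchoose (gP x).
have dlogP x : x != 0 -> x = gamma ^+ dlog x.
  by move=> x0; apply/eqP; move: x0; apply/implyP; exact: (xchooseP (gP x)).
have zmod m n : m = n %[mod 8 * f] -> zeta ^+ m = zeta ^+ n.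
  move=> E; rewrite (divn_eq m (8 * f)) (divn_eq n (8 * f)) E !exprD.
  by rewrite !(mulnC _ (8 * f)) -!mulnA !(exprM _ 8) z8 !expr1n.
have f0 : (0 < f)%N by have := order_gt0 g; rewrite og; case: (f).
have half1 : gamma ^+ (4 * f) != 1.
  apply/eqP; rewrite -(expr0 gamma) => /gE; rewrite mod0n modn_small; last by lia.
  by lia.
have half : gamma ^+ (4 * f) = -1.
  have : (gamma ^+ (4 * f)) ^+ 2 == 1.
    by rewrite -exprM gX -[1](_ : val (1%g : {unit F}) = 1) // mulnC mulnA -og expg_order.
  by rewrite sqrf_eq1 (negbTE half1) => /eqP.
pose chi x := if x == 0 then 0 else zeta ^+ dlog x.
have chiX n : chi (gamma ^+ n) = zeta ^+ n.
  rewrite /chi expf_eq0 (negbTE g0) andbF; apply: zmod; apply: gE.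
  by rewrite -dlogP // expf_neq0.
exists chi, gamma; split=> //.
- split; first by rewrite /chi eqxx.
    by rewrite -(expr0 gamma) chiX.
  move=> x y; have [->|/dlogP Ex] := eqVneq x 0; first by rewrite mul0r /chi eqxx mul0r.
  have [->|/dlogP Ey] := eqVneq y 0; first by rewrite mulr0 /chi eqxx mulr0.
  by rewrite Ex Ey -exprD !chiX exprD.
- by rewrite -(expr1 gamma) chiX.
- by move=> x /dlogP Ex; exists (dlog x).
- apply/eqP => two0; case/eqP: half1; rewrite half; apply/eqP.
  by rewrite eq_sym -subr_eq0 opprK; apply/eqP.
Qed.

Section OcticJacobi.

Variables (F : finFieldType) (L : numFieldType) (f : nat) (zeta : L).
Variables (chi : F -> L) (gamma : F).
Hypothesis oct : octic_char f zeta chi gamma.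

Let z4 := octic_zeta oct.
Let hchi := octic_mult oct.

Lemma octic_zeta8 : zeta ^+ 8 = 1.
Proof. by rewrite (exprM zeta 4 2) z4 sqrrN expr1n. Qed.

Lemma octic_gen_neq0 : gamma != 0.
Proof.
apply/eqP => g0; have := octic_gen oct; rewrite g0 (mult_char0 hchi) => z0.
by move/eqP: z4; rewrite -z0 expr0n /= eq_sym oppr_eq0 oner_eq0.
Qed.

Lemma octic_char_gen n : chi (gamma ^+ n) = zeta ^+ n.
Proof.
elim: n => [|n IH]; first by rewrite !expr0 (mult_char1 hchi).
by rewrite !exprS (mult_charM hchi) IH (octic_gen oct).
Qed.

Lemma octic_char8 x : x != 0 -> chi x ^+ 8 = 1.
Proof.
by case/(octic_genP oct) => n ->; rewrite octic_char_gen exprAC octic_zeta8 expr1n.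
Qed.

Lemma octic_charN1 : chi (-1) = (-1) ^+ f.
Proof. by rewrite -(octic_half oct) octic_char_gen exprM z4. Qed.

(** 2 is a square, with root w + w^-1 for a primitive eighth root of unity w. *)
Lemma octic_char2 : chi 2 ^+ 4 = 1.
Proof.
pose w := gamma ^+ f.
have w4 : w ^+ 4 = -1 by rewrite -(octic_half oct) mulnC exprM.
have w0 : w != 0 by rewrite expf_neq0 // octic_gen_neq0.
have E : 2 = (w + w^-1) ^+ 2.
  apply/eqP; rewrite -subr_eq0; apply/eqP.
  have -> : 2 - (w + w^-1) ^+ 2 = - (w ^+ 4 + 1) / w ^+ 2 by field.
  by rewrite w4 addNr oppr0 mul0r.
have u0 : w + w^-1 != 0.
  by apply/eqP => u0; move: E (octic_two oct); rewrite u0 expr0n => ->; rewrite eqxx.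
by rewrite E expr2 (mult_charM hchi) -expr2 -exprM octic_char8.
Qed.

Lemma octic_char4 : chi 4 = chi 2 ^+ 2.
Proof. by rewrite expr2 -(mult_charM hchi) -natrM. Qed.

Let X m x := chi x ^+ m.
(** J(m, n), the Jacobi sum of the m-th and n-th powers of chi. *)
Definition octic_jacobi m n := jacobi (X m) (X n).
Let J := octic_jacobi.

Let hX m : (0 < m)%N -> mult_char (X m).
Proof. by move=> m0; apply: mult_charX. Qed.

Lemma octic_zetaX_neq1 m : ~~ (8 %| m)%N -> zeta ^+ m != 1.
Proof.
rewrite (divn_eq m 8) exprD mulnC exprM octic_zeta8 expr1n mul1r dvdn_addr ?dvdn_mulr //.
have : (m %% 8 < 8)%N by rewrite ltn_mod.
have N1 : -1 != 1 :> L by rewrite eq_sym -subr_eq0 opprK -(natrD _ 1 1) pnatr_eq0.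
have key k l : zeta ^+ (k * l) = -1 -> zeta ^+ k != 1.
  by move=> E; apply/eqP => E1; move: E; rewrite exprM E1 expr1n => /esym/eqP; rewrite (negbTE N1).
have key2 k : odd k -> zeta ^+ (k * 4) = -1.
  by move=> ok; rewrite mulnC exprM z4 -signr_odd ok.
case: (m %% 8)%N => [|[|[|[|[|[|[|[|//]]]]]]]] // _ _.
- by apply: (key _ 4); apply: key2.
- by apply: (key _ 2).
- by apply: (key _ 4); apply: key2.
- by apply: (key _ 1).
- by apply: (key _ 4); apply: key2.
- by apply: (key _ 2); apply: (key2 3).
- by apply: (key _ 4); apply: key2.
Qed.

Lemma octic_zeta_prim : 8.-primitive_root zeta.
Proof.
apply/andP; split=> //; apply/forallP => i; rewrite unity_rootE.
have [->|i8] := eqVneq i.+1 8%N; first by rewrite octic_zeta8 !eqxx.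
rewrite eqbF_neg octic_zetaX_neq1 //; apply/negP => /(dvdn_leq (isT : 0 < i.+1)%N) i7.
by case/eqP: i8; apply/eqP; rewrite eqn_leq i7 ltn_ord.
Qed.

Let nontriv m : ~~ (8 %| m)%N -> X m gamma != 1.
Proof. by move=> m8; rewrite /X (octic_gen oct) octic_zetaX_neq1. Qed.

Let inv3 m n r : (8 %| m + n + r)%N -> forall x, x != 0 -> X m x * X n x * X r x = 1.
Proof.
by case/dvdnP=> k E x x0; rewrite /X -!exprD E mulnC exprM octic_char8 ?expr1n.
Qed.

Let inv2 m n : (8 %| m + n)%N -> forall x, x != 0 -> X m x * X n x = 1.
Proof.
by case/dvdnP=> k E x x0; rewrite /X -!exprD E mulnC exprM octic_char8 ?expr1n.
Qed.

Lemma octic_jacobiC m n : J m n = J n m.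
Proof. exact: jacobiC. Qed.

Lemma octic_jacobi_flip m n r : (0 < m)%N -> (0 < n)%N -> (0 < r)%N -> (8 %| m + n + r)%N ->
  J m n = chi (-1) ^+ m * J m r.
Proof.
by move=> m0 n0 r0 mnr; apply: jacobi_flip; [exact: hX..|apply: inv3].
Qed.

Lemma octic_jacobi_inv m n : (0 < m)%N -> (0 < n)%N -> (8 %| m + n)%N -> ~~ (8 %| m)%N ->
  J m n = - chi (-1) ^+ m.
Proof.
move=> m0 n0 mn m8.
by apply: (jacobi_inv (hX m0) (hX n0) octic_gen_neq0 (nontriv m8)); apply: inv2.
Qed.

Lemma octic_jacobi8 m : (0 < m)%N -> ~~ (8 %| m)%N -> J 8 m = -1.
Proof.
move=> m0 m8; rewrite octic_jacobiC -(jacobi_trivial (hX m0) octic_gen_neq0 (nontriv m8)).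
apply: eq_bigr => t _; congr (_ * _); rewrite /X /trivial_char.
by have [->|/octic_char8 ->] := eqVneq; rewrite ?(mult_char0 hchi) ?expr0n.
Qed.

Let rho_sqr x : x != 0 -> X 4 x ^+ 2 = 1.
Proof. by move=> x0; rewrite /X -exprM octic_char8. Qed.

Let rho_count (y : F) : \sum_x (x ^+ 2 == y)%:R = 1 + X 4 y.
Proof.
have [->|/(octic_genP oct)[n ->]] := eqVneq y 0.
  rewrite /X (mult_char0 hchi) expr0n /= addr0 (bigD1 0) //= expr0n eqxx big1 ?addr0 //.
  by move=> x x0; rewrite sqrf_eq0 (negbTE x0).
have rn : X 4 (gamma ^+ n) = (-1) ^+ odd n.
  by rewrite /X octic_char_gen exprAC z4 signr_odd.
rewrite rn; case: (boolP (odd n)) => [on|en].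
  rewrite expr1 subrr big1 // => x _; case: eqP => // E.
  have x0 : x != 0 by rewrite -sqrf_eq0 E expf_neq0 ?octic_gen_neq0.
  have := rn; rewrite -E /X expr2 (mult_charM hchi) -expr2 -exprM octic_char8 // on expr1.
  by move/eqP; rewrite -subr_eq0 opprK -(natrD _ 1 1) pnatr_eq0.
pose s := gamma ^+ n./2.
have -> : gamma ^+ n = s ^+ 2 by rewrite /s -exprM muln2 even_halfK.
have s0 : s != 0 by rewrite expf_neq0 ?octic_gen_neq0.
have sN : - s != s.
  by rewrite eq_sym -subr_eq0 opprK -mulr2n -mulr_natl mulf_neq0 ?(octic_two oct).
rewrite (bigD1 s) //= eqxx (bigD1 (- s)) //= sqrrN eqxx expr0 big1 ?addr0 // => x /andP[xs xN].
by rewrite eqf_sqr (negbTE xs) (negbTE xN).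
Qed.

Lemma octic_jacobi_diag m : (0 < m)%N -> ~~ (8 %| m)%N -> chi 4 ^+ m * J m m = J m 4.
Proof.
move=> m0 m8.
exact: (jacobi_diag (hX m0) (octic_two oct) rho_count octic_gen_neq0 (nontriv m8)).
Qed.

Lemma octic_jacobi_twist m n k : (0 < m)%N -> (0 < n)%N -> (0 < k)%N ->
  n = m + 4 %[mod 8] -> k = 2 * m %[mod 8] -> chi 4 ^+ m * J m n = J k 4.
Proof.
move=> m0 n0 k0 En Ek.
have modX i j (x : F) : (0 < i)%N -> (0 < j)%N -> i = j %[mod 8] -> X i x = X j x.
  move=> i0 j0 E; have [->|x0] := eqVneq x 0.
    by rewrite /X (mult_char0 hchi) !expr0n !eqn0Ngt i0 j0.
  rewrite /X (divn_eq i 8) (divn_eq j 8) E !exprD !(mulnC _ 8%N) !exprM.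
  by rewrite octic_char8 // !expr1n.
have -> : J m n = jacobi (X m) (fun x => X m x * X 4 x).
  apply: eq_bigr => t _; congr (_ * _); rewrite (modX n (m + 4)%N) ?addn_gt0 ?m0 //.
  by rewrite /X exprD.
have -> : J k 4 = jacobi (fun x => X m x ^+ 2) (X 4).
  apply: eq_bigr => t _; congr (_ * _); rewrite (modX k (2 * m)%N) ?muln_gt0 //.
  by rewrite /X mulnC exprM.
exact: (jacobi_twist (hX m0) (hX (isT : 0 < 4)%N) (octic_two oct) rho_sqr rho_count).
Qed.

End OcticJacobi.

(** * Integer coordinates of octic Jacobi sums *)

Section OcticIntegers.

Variables (F : finFieldType) (L : numFieldType) (f : nat) (zeta : L).
Variables (chi : F -> L) (gamma : F).
Hypothesis oct : octic_char f zeta chi gamma.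

Let hchi := octic_mult oct.
Let z4 := octic_zeta oct.
Let J := octic_jacobi chi.

Let quartic_int x : exists s : int, chi x ^+ 4 = s%:~R.
Proof.
have [->|/(octic_genP oct)[n ->]] := eqVneq x 0.
  by exists 0; rewrite (mult_char0 hchi) expr0n.
exists ((-1) ^+ n); rewrite (octic_char_gen oct) exprAC z4.
by rewrite rmorphXn rmorphN1.
Qed.

Let zeta4j j : odd j -> zeta ^+ (4 * j) = -1.
Proof. by move=> oj; rewrite exprM z4 -signr_odd oj. Qed.

Let zetaD4 n j : odd j -> zeta ^+ ((n + 4) * j) = - zeta ^+ (n * j).
Proof. by move=> oj; rewrite mulnDl exprD zeta4j // mulrN1. Qed.

Let power_int n : exists c0 c1 c2 c3 : int, forall j, odd j ->
  zeta ^+ (n * j) = c0%:~R + c1%:~R * zeta ^+ j + c2%:~R * zeta ^+ (2 * j)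
                    + c3%:~R * zeta ^+ (3 * j).
Proof.
elim/ltn_ind: n => -[|[|[|[|n]]]] IH.
- by exists 1, 0, 0, 0 => j _; rewrite mul0n expr0; ring.
- by exists 0, 1, 0, 0 => j _; rewrite mul1n; ring.
- by exists 0, 0, 1, 0 => j _; ring.
- by exists 0, 0, 0, 1 => j _; ring.
have [|c0 [c1 [c2 [c3 E]]]] := IH n; first by lia.
exists (- c0), (- c1), (- c2), (- c3) => j oj.
by rewrite -addn4 zetaD4 // E // !rmorphN; ring.
Qed.

(** The coefficients are shared by all odd j: replacing chi by its j-th power is the
    Galois action zeta |-> zeta ^+ j. *)
Lemma octic_jacobi_int : exists c0 c1 c2 c3 : int, forall j, odd j ->
  J j 4 = c0%:~R + c1%:~R * zeta ^+ j + c2%:~R * zeta ^+ (2 * j)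
                    + c3%:~R * zeta ^+ (3 * j).
Proof.
rewrite /J /octic_jacobi /jacobi; elim: (index_enum F) => [|t r [c0 [c1 [c2 [c3 IH]]]]].
  by exists 0, 0, 0, 0 => j _; rewrite big_nil; ring.
have [s Es] := quartic_int (1 - t).
have [->|/(octic_genP oct)[n En]] := eqVneq t 0.
  exists c0, c1, c2, c3 => j oj; rewrite big_cons IH // (mult_char0 hchi) expr0n.
  by rewrite (gtn_eqF (odd_gt0 oj)) mul0r add0r.
have [d0 [d1 [d2 [d3 Ed]]]] := power_int n.
exists (c0 + d0 * s), (c1 + d1 * s), (c2 + d2 * s), (c3 + d3 * s) => j oj.
rewrite big_cons IH // Es En (octic_char_gen oct) -exprM Ed // !rmorphD !rmorphM /=.
ring.
Qed.

Lemma octic_jacobi_gauss_int : exists a b : int, forall j, odd j ->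
  J (2 * j) 4 = a%:~R + b%:~R * zeta ^+ (2 * j).
Proof.
rewrite /J /octic_jacobi /jacobi; elim: (index_enum F) => [|t r [a [b IH]]].
  by exists 0, 0 => j _; rewrite big_nil; ring.
have [s Es] := quartic_int (1 - t).
have [->|/(octic_genP oct)[n En]] := eqVneq t 0.
  exists a, b => j oj; rewrite big_cons IH // (mult_char0 hchi) expr0n.
  by rewrite muln_eq0 /= (gtn_eqF (odd_gt0 oj)) mul0r add0r.
have [d0 [d1 Ed]] : exists d0 d1 : int, forall j, odd j ->
    zeta ^+ (n * (2 * j)) = d0%:~R + d1%:~R * zeta ^+ (2 * j).
  elim/ltn_ind: n {En} => -[|[|n]] IHn.
  - by exists 1, 0 => j _; rewrite mul0n expr0; ring.
  - by exists 0, 1 => j _; rewrite mul1n; ring.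
  have [|d0 [d1 E]] := IHn n; first by lia.
  exists (- d0), (- d1) => j oj; rewrite -addn2 mulnDl exprD E //.
  have -> : (2 * (2 * j) = 4 * j)%N by rewrite mulnA.
  by rewrite zeta4j // !rmorphN; ring.
exists (a + d0 * s), (b + d1 * s) => j oj.
rewrite big_cons IH // Es En (octic_char_gen oct) -exprM Ed // !rmorphD !rmorphM /=.
ring.
Qed.

(** The square of (a - c) = (d - b) * zeta ^+ 2 makes a sum of two integer squares
    vanish. *)
Lemma gauss_int_inj (a b c d : int) :
  a%:~R + b%:~R * zeta ^+ 2 = c%:~R + d%:~R * zeta ^+ 2 -> a = c /\ b = d.
Proof.
move=> E; have : ((a - c) ^+ 2 + (b - d) ^+ 2)%:~R = 0 :> L.
  have E2 : (a - c)%:~R = (d - b)%:~R * zeta ^+ 2.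
    rewrite !rmorphB /= mulrBl; apply/eqP; rewrite subr_eq addrAC eq_sym subr_eq.
    by rewrite addrC -E addrC.
  rewrite rmorphD !rmorphXn /= E2 exprMn -exprM z4 mulrN1 -rmorphXn /= -rmorphXn /= -rmorphN -rmorphD.
  by rewrite -sqrrN opprB addNr.
move/eqP; rewrite intr_eq0 paddr_eq0 ?sqr_ge0 // !sqrf_eq0 !subr_eq0.
by case/andP=> /eqP -> /eqP ->.
Qed.

Let e := chi (-1).
Let eps := chi 4.

Let e2 : e ^+ 2 = 1.
Proof. by rewrite /e (octic_charN1 oct) -exprM mulnC exprM sqrrN !expr1n. Qed.

Lemma octic_char4_sqr : chi 4 ^+ 2 = 1.
Proof. by rewrite (octic_char4 oct) -exprM (octic_char2 oct). Qed.
Let eps2 := octic_char4_sqr.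

Let e_odd n : e ^+ (n.*2.+1) = e.
Proof. by rewrite exprS -mul2n exprM e2 expr1n mulr1. Qed.
Let e_even n : e ^+ (n.*2) = 1.
Proof. by rewrite -mul2n exprM e2 expr1n. Qed.
Let eps_odd n u v : eps ^+ (n.*2.+1) * u = v -> u = eps * v.
Proof.
move=> <-; rewrite exprS -mul2n exprM eps2 expr1n mulr1 mulrA.
by rewrite -expr2 eps2 mul1r.
Qed.

Let JC m n : J m n = J n m.
Proof. exact: octic_jacobiC. Qed.
(** Each J(m, k) with k = 1, 2, 4 in terms of J(1, 4), J(7, 4), J(2, 4), J(6, 4). *)
Let J31 : J 3 1 = e * J 1 4.
Proof.
rewrite [J 1 4](octic_jacobi_flip oct (r := 3)) // -/e expr1 mulrA -expr2 e2 mul1r.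
exact: JC.
Qed.
Let J34 : J 3 4 = J 1 4.
Proof. by rewrite [LHS](octic_jacobi_flip oct (r := 1)) // -/J J31 -/e (e_odd 1) mulrA -expr2 e2 mul1r. Qed.
Let J54 : J 5 4 = J 7 4.
Proof.
rewrite [LHS](octic_jacobi_flip oct (r := 7)) // [RHS](octic_jacobi_flip oct (r := 5)) //.
by rewrite -/e (e_odd 2) (e_odd 3) -!/J JC.
Qed.
Let J44 : J 4 4 = -1.
Proof. by rewrite [LHS](octic_jacobi_inv oct) // -/e (e_even 2). Qed.
Let J8 m : (0 < m)%N -> ~~ (8 %| m)%N -> J 8 m = -1.
Proof. exact: (octic_jacobi8 oct). Qed.
Let J15 : J 1 5 = eps * J 2 4.
Proof. by apply: (eps_odd (n := 0)); apply: (octic_jacobi_twist oct). Qed.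
Let J12 : J 1 2 = e * (eps * J 2 4).
Proof. by rewrite [LHS](octic_jacobi_flip oct (r := 5)) // -/J J15. Qed.
Let J22 : J 2 2 = J 2 4.
Proof. by rewrite -[RHS](octic_jacobi_diag oct) // -/eps eps2 mul1r. Qed.
Let J32 : J 3 2 = e * (eps * J 1 4).
Proof.
rewrite [LHS](octic_jacobi_flip oct (r := 3)) // -/J -/e (e_odd 1); congr (_ * _).
by rewrite -J34; apply: (eps_odd (n := 1)); apply: (octic_jacobi_diag oct).
Qed.
Let J72 : J 7 2 = e * (eps * J 7 4).
Proof.
rewrite [LHS](octic_jacobi_flip oct (r := 7)) // -/J -/e (e_odd 3); congr (_ * _).
by apply: (eps_odd (n := 3)); apply: (octic_jacobi_diag oct).
Qed.
Let J52 : J 5 2 = J 1 2.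
Proof.
by rewrite JC [LHS](octic_jacobi_flip oct (r := 1)) // -/J -/e e2 mul1r JC.
Qed.
Let J62 : J 6 2 = -1.
Proof. by rewrite [LHS](octic_jacobi_inv oct) // -/e (e_even 3). Qed.
Let J11 : J 1 1 = eps * J 1 4.
Proof. by apply: (eps_odd (n := 0)); apply: (octic_jacobi_diag oct). Qed.
Let J61 : J 6 1 = e * (eps * J 1 4).
Proof. by rewrite JC [LHS](octic_jacobi_flip oct (r := 1)) // -/J -/e J11. Qed.
Let J71 : J 7 1 = - e.
Proof. by rewrite [LHS](octic_jacobi_inv oct) // -/e (e_odd 3). Qed.

Lemma sum_octic_jacobi4 :
  \sum_(m < 8) J m.+1 4 = 2 * (J 1 4 + J 7 4) + (J 2 4 + J 6 4) - 2.
Proof. by rewrite !big_ord_recr big_ord0 /= J34 J44 J54 J8 //; ring. Qed.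

Lemma sum_octic_jacobi2 :
  \sum_(m < 8) J m.+1 2 =
    2 * (1 + chi (-1) * chi 4) * J 2 4 + chi (-1) * chi 4 * (J 1 4 + J 7 4) - 2.
Proof.
rewrite !big_ord_recr big_ord0 /= J52 J12 J22 J32 (JC 4 2) -!/J J62 J72 J8 //.
by rewrite /e /eps; ring.
Qed.

Lemma sum_octic_jacobi1 : chi (-1) = 1 ->
  \sum_(m < 8) J m.+1 1 = 2 * (1 + chi 4) * J 1 4 + 2 * chi 4 * J 2 4 - 2.
Proof.
move=> e1; rewrite !big_ord_recr big_ord0 /= J11 (JC 2 1) -!/J J12 J31.
rewrite (JC 4 1) (JC 5 1) -!/J J15 J61 J71 J8 //.
by rewrite /e e1 /eps; ring.
Qed.

(** J(1, 4) = J(3, 4) says that J(1, 4) is fixed by zeta |-> zeta ^+ 3, hence is an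
    integer combination of 1 and zeta + zeta ^+ 3, a square root of -2. *)
Lemma octic_jacobi_values : exists a b x y : int,
  [/\ #|F|%:Z = a ^+ 2 + b ^+ 2, #|F|%:Z = x ^+ 2 + 2 * y ^+ 2,
      J 2 4 = a%:~R + b%:~R * zeta ^+ 2, J 2 4 + J 6 4 = (2 * a)%:~R
    & J 1 4 + J 7 4 = (2 * x)%:~R].
Proof.
have [a [b Eab]] := octic_jacobi_gauss_int.
have [x [y [c2 [c3 Ec]]]] := octic_jacobi_int.
have z8 := octic_zeta8 oct.
have E24 : J 2 4 = a%:~R + b%:~R * zeta ^+ 2 by rewrite (Eab 1%N).
have E64 : J 6 4 = a%:~R - b%:~R * zeta ^+ 2 by rewrite (Eab 3%N) //; ring: z4.
have E14 := Ec 1%N isT; have E34 := Ec 3%N isT; have E74 := Ec 7%N isT.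
have [Ey Ec2] : y = c3 /\ c2 = 0.
  have E : (y - c3)%:~R * (zeta - zeta ^+ 3) = - (2 * c2)%:~R * zeta ^+ 2.
    apply/eqP; rewrite -subr_eq0 -(subrr (J 1 4)) -{2}J34 E14 E34 rmorphB rmorphM /=; apply/eqP.
    ring: z4.
  have : (2 * ((y - c3) ^+ 2 + 2 * c2 ^+ 2))%:~R = 0 :> L.
    have <- : ((y - c3)%:~R * (zeta - zeta ^+ 3)) ^+ 2 - (- (2 * c2)%:~R * zeta ^+ 2) ^+ 2 = 0.
      by rewrite E subrr.
    by rewrite !(rmorphM, rmorphD, rmorphXn, rmorphB) /=; ring: z4.
  have h2 : 0 <= 2 * c2 ^+ 2 by rewrite pmulr_rge0 // sqr_ge0.
  move/eqP; rewrite intr_eq0 mulf_eq0 /= paddr_eq0 ?sqr_ge0 //.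
  by rewrite sqrf_eq0 [2 * _ == 0]mulf_eq0 /= sqrf_eq0 subr_eq0 => /andP[/eqP -> /eqP ->].
have norm m n : (0 < m)%N -> (0 < n)%N -> (8 %| m + n)%N -> ~~ (8 %| m)%N -> ~~ (8 %| m + 4)%N ->
    J m 4 * J n 4 = #|F|%:R.
  move=> m0 n0 mn m8 m48; have g0 := octic_gen_neq0 oct.
  have inv2 k l : (8 %| k + l)%N -> forall x, x != 0 -> chi x ^+ k * chi x ^+ l = 1.
    case/dvdnP=> q Eq t t0; rewrite -exprD Eq mulnC exprM (octic_char8 oct) //.
    by rewrite expr1n.
  have X k : (0 < k)%N -> mult_char (fun t => chi t ^+ k) by move=> k0; apply: mult_charX.
  have ne k : ~~ (8 %| k)%N -> chi gamma ^+ k != 1.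
    by move=> k8; rewrite (octic_gen oct) (octic_zetaX_neq1 oct).
  apply: (jacobi_norm (X _ m0) (X 4 isT) (X _ n0) (X 4 isT) (inv2 _ _ mn) (inv2 4 4 isT)%N
    g0 (ne _ m8) g0 (ne 4 isT)%N g0).
  by rewrite -exprD ne.
have E14' : J 1 4 = x%:~R + y%:~R * (zeta + zeta ^+ 3) by rewrite E14 -Ey Ec2; ring.
have E74' : J 7 4 = x%:~R - y%:~R * (zeta + zeta ^+ 3) by rewrite E74 -Ey Ec2; ring: z4.
exists a, b, x, y; split=> //.
- apply: (@intr_inj L); rewrite -[LHS](norm 2 6) // E24 E64 !(rmorphM, rmorphD, rmorphXn) /=.
  by ring: z4.
- apply: (@intr_inj L); rewrite -[LHS](norm 1 7)%N // E14' E74' !(rmorphM, rmorphD, rmorphXn) /=.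
  by ring: z4.
- by rewrite E24 E64 rmorphM /=; ring.
- by rewrite E14' E74' rmorphM /=; ring.
Qed.

End OcticIntegers.

(** * Difference counts *)

Section DifferenceCount.

Variable G : finZmodType.
Implicit Types (D : {set G}) (g : G).

Lemma difference_countN D g : difference_count D (- g) = difference_count D g.
Proof.
rewrite /difference_count.
have inj : injective (fun d : G * G => (d.2, d.1)) by move=> [a b] [c d] [-> ->].
rewrite -(card_preimset _ inj).
by apply: eq_card => -[a b]; rewrite !inE /= andbCA -(inj_eq oppr_inj) opprB opprK.
Qed.

Lemma sum_difference_count (L : pzSemiRingType) D (h : G -> L) :
  \sum_g (difference_count D g)%:R * h g = \sum_(a in D) \sum_(b in D) h (a - b).
Proof.
transitivity (\sum_g \sum_(d : G * G | (d.1 \in D) && (d.2 \in D)) (d.1 - d.2 == g)%:R * h g).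
  apply: eq_bigr => g _; rewrite -mulr_suml; congr (_ * _).
  rewrite /difference_count -sum1_card natr_sum big_mkcond [RHS]big_mkcond /=.
  apply: eq_bigr => d _; rewrite inE; case: (d.1 \in D); case: (d.2 \in D) => //=.
  by case: eqP.
rewrite exchange_big [RHS]pair_big /=; apply: eq_bigr => d _.
rewrite (bigD1 (d.1 - d.2)) //= eqxx mul1r big1 ?addr0 // => g /negbTE.
by rewrite eq_sym => ->; rewrite mul0r.
Qed.

(** Solutions of a - b = g in a symmetric set pair off under (a, b) |-> (- b, - a);
    a fixed solution has a = h, half of g. *)
Lemma odd_difference_count D g h : (forall x, (- x \in D) = (x \in D)) ->
  (forall x, (x + x == g) = (x == h)) -> odd (difference_count D g) = (h \in D).
Proof.
move=> DN half.
have -> : difference_count D g = #|[set a in D | a - g \in D]|.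
  rewrite /difference_count -(card_imset _ (_ : injective (fun a => (a, a - g)))); last by move=> a b [].
  apply: eq_card => -[a b]; rewrite !inE /=; apply/and3P/imsetP => [[aD bD /eqP <-]|[c]].
    by exists a; rewrite ?inE subKr ?aD.
  by rewrite inE => /andP[cD gD] [-> ->]; rewrite subKr.
set S := [set _ | _].
have SJ a : (g - a \in S) = (a \in S).
  by rewrite !inE addrAC subrr add0r DN andbC -opprB DN.
have hS : (h \in S) = (h \in D).
  have /eqP Eh : h + h == g by rewrite half.
  by rewrite !inE -Eh opprD addrA subrr add0r DN andbb.
have fixh a : (g - a == a) = (a == h) by rewrite subr_eq eq_sym half.
rewrite -hS; clearbody S; rewrite -(cardsID [set h] S) oddD; set T := S :\: _.
have -> : odd #|S :&: [set h]| = (h \in S).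
  case: (boolP (h \in S)) => hS'.
    by rewrite (setIidPr _) ?cards1 // sub1set.
  rewrite (_ : _ :&: _ = set0) ?cards0 //; apply/setP => x; rewrite !inE.
  by apply/negP => /andP[xS /eqP xh]; case/negP: hS'; rewrite -xh.
suff -> : odd #|T| = false by rewrite addbF.
(* off the fixed point, exactly one element of each pair {a, g - a} satisfies r a (g - a) *)
pose r (a b : G) := (enum_rank a < enum_rank b)%N.
rewrite -(cardsID [set a | r a (g - a)] T).
have -> : #|T :\: [set a | r a (g - a)]| = #|T :&: [set a | r a (g - a)]|.
  rewrite -(card_preimset _ (inv_inj (subKr g))); apply: eq_card => a.
  rewrite !(inE, in_setD, in_setI) SJ subKr; case: (a \in S); rewrite ?andbF //= !andbT.
  have -> : (g - a == h) = (a == h) by rewrite -fixh subKr eq_sym fixh.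
  rewrite andbC; have [//|ah] := eqVneq a h; rewrite /= /r -leqNgt leq_eqVlt.
  by rewrite (inj_eq val_inj) (inj_eq enum_rank_inj) eq_sym fixh (negbTE ah).
by rewrite addnn odd_double.
Qed.

Lemma almost_difference_setP v D : #|G| = v ->
  (exists k lambda t, (0 < t < v - 1)%N /\ almost_difference_set v k lambda t D) <->
  exists lambda, [/\ (forall g, g != 0 -> difference_count D g \in [:: lambda; lambda.+1]),
     (exists2 g, g != 0 & difference_count D g = lambda) &
     (exists2 g, g != 0 & difference_count D g = lambda.+1)].
Proof.
move=> <-; split=> [[k [l [t [/andP[t0 tq] [_ _ Et H]]]]]|[l [H [g g0 Eg] [g' g'0 Eg']]]].
  have all2 g : g != 0 -> difference_count D g \in [:: l; l.+1].
    by move=> g0; rewrite !inE; have [//|/(H _ g0) ->] := eqVneq; rewrite eqxx.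
  exists l; split=> //.
    by move: t0; rewrite -Et => /card_gt0P[g]; rewrite inE => /andP[g0 /eqP]; exists g.
  case: (pickP (fun g => (g != 0) && (difference_count D g != l))) => [g /andP[g0 gl]|none].
    by exists g => //; apply: H.
  suff : t = (#|G| - 1)%N by move=> Et'; rewrite Et' ltnn in tq.
  rewrite -Et subn1 -(cardC1 (0 : G)); apply: eq_card => g; rewrite !inE.
  by have := none g; case: (g != 0) => //= /negbFE.
exists #|D|, l, #|[set g : G | (g != 0) && (difference_count D g == l)]|; split; last first.
  split=> // h h0; have := H h h0; rewrite !inE => /orP[->//|/eqP //].
apply/andP; split; first by apply/card_gt0P; exists g; rewrite inE g0 Eg eqxx.
rewrite subn1 -(cardC1 (0 : G)); apply: proper_card; apply/properP; split.
  by apply/subsetP => h; rewrite !inE => /andP[].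
by exists g'; rewrite !inE ?g'0 // Eg' eqn_leq ltnn.
Qed.

End DifferenceCount.

Section OcticDifferences.

Variables (F : finFieldType) (L : numFieldType) (f : nat) (zeta : L).
Variables (chi : F -> L) (gamma : F).
Hypothesis oct : octic_char f zeta chi gamma.

Let hchi := octic_mult oct.
Let C := octic_residues F.
Let D := 0 |: C.
Let N g := difference_count D g.

Lemma octic_residueP x : (x \in C) = (chi x == 1).
Proof.
apply/imsetP/eqP => [[y]|chix].
  by rewrite inE => y0 ->; rewrite -(octic_char8 oct y0) !exprS expr0 !(mult_charM hchi) (mult_char1 hchi).
have x0 : x != 0 by apply/eqP => x0; move/eqP: chix; rewrite x0 (mult_char0 hchi) eq_sym oner_eq0.
have [n En] := octic_genP oct x0; move: chix; rewrite En (octic_char_gen oct) => /eqP zn.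
have /dvdnP[k Ek] : (8 %| n)%N by apply: contraLR zn => /(octic_zetaX_neq1 oct).
exists (gamma ^+ k); first by rewrite inE expf_neq0 ?(octic_gen_neq0 oct).
by rewrite Ek exprM.
Qed.

Lemma octic_residue_neq0 x : x \in C -> x != 0.
Proof.
rewrite octic_residueP => /eqP cx; apply/eqP => x0; move/eqP: cx.
by rewrite x0 (mult_char0 hchi) eq_sym oner_eq0.
Qed.

Lemma card_octic_residues_neq0 : #|C|%:R != 0 :> L.
Proof.
by rewrite pnatr_eq0 -lt0n; apply/card_gt0P; exists 1; rewrite octic_residueP (mult_char1 hchi).
Qed.

Lemma sum_octic_powers x : \sum_(m < 8) chi x ^+ m.+1 = 8 * (x \in C)%:R.
Proof.
rewrite octic_residueP; have [->|x0] := eqVneq x 0.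
  rewrite (mult_char0 hchi) eq_sym oner_eq0 mulr0n mulr0 big1 // => m _.
  by rewrite expr0n.
have [->|c1] := eqVneq (chi x) 1.
  by rewrite mulr1; under eq_bigr do rewrite expr1n; rewrite sumr_const card_ord.
rewrite mulr0n mulr0; under eq_bigr do rewrite exprS.
rewrite -mulr_sumr; have := subrX1 (chi x) 8; rewrite (octic_char8 oct x0) subrr.
by move/esym/eqP; rewrite mulf_eq0 subr_eq0 (negbTE c1) => /eqP ->; rewrite mulr0.
Qed.

Lemma octic_residue_mul c x : c \in C -> (c * x \in C) = (x \in C).
Proof. by rewrite !octic_residueP (mult_charM hchi) => /eqP ->; rewrite mul1r. Qed.

Lemma difference_count_mul c g : c \in C -> N (c * g) = N g.
Proof.
move=> cC; have c0 := octic_residue_neq0 cC.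
have inj : injective (fun d : F * F => (c * d.1, c * d.2)).
  by move=> [a b] [a' b'] [/(mulfI c0) -> /(mulfI c0) ->].
rewrite /N /difference_count -(card_preimset _ inj); apply: eq_card => -[a b].
by rewrite !inE /= -mulrBr (inj_eq (mulfI c0)) !mulf_eq0 (negbTE c0) !octic_residue_mul.
Qed.

(** Pairs with an entry 0 contribute 1 + chi (-1) ^+ k; in the others the ratio c of
    the two entries runs over C, whose indicator is the mean of the eight powers
    of chi. *)
Lemma octic_difference_fourier k : (0 < k)%N ->
  8 * \sum_g (N g)%:R * chi g ^+ k =
  #|C|%:R * (8 * (1 + chi (-1) ^+ k) + \sum_(m < 8) octic_jacobi chi m.+1 k).
Proof.
move=> k0; rewrite sum_difference_count.
have C0 : 0 \notin C by apply/negP => /octic_residue_neq0; rewrite eqxx.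
have chi0 : chi 0 ^+ k = 0 by rewrite (mult_char0 hchi) expr0n eqn0Ngt k0.
rewrite /D big_setU1 //= big_setU1 //= subrr chi0 add0r.
under [X in _ + X]eq_bigr => a aC.
  rewrite big_setU1 //= subr0.
  have -> : chi a ^+ k = 1 by have := aC; rewrite octic_residueP => /eqP ->; rewrite expr1n.
  have -> : \sum_(b in C) chi (a - b) ^+ k = \sum_(c in C) chi (1 - c) ^+ k.
    rewrite (reindex_inj (mulfI (octic_residue_neq0 aC))) /=; apply: eq_big => c.
      by rewrite octic_residue_mul.
    move=> _; rewrite -{1}[a]mulr1 -mulrBr (mult_charM hchi).
    by have := aC; rewrite octic_residueP => /eqP ->; rewrite mul1r.
  over.
under eq_bigr => b bC.
  rewrite sub0r -mulN1r (mult_charM hchi).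
  have -> : chi b = 1 by have := bC; rewrite octic_residueP => /eqP.
  rewrite mulr1; over.
rewrite !sumr_const -(mulr_natl (chi (-1) ^+ k)) -(mulr_natl (1 + _)).
have -> : \sum_(m < 8) octic_jacobi chi m.+1 k = 8 * \sum_(c in C) chi (1 - c) ^+ k.
  rewrite exchange_big /= mulr_sumr [RHS]big_mkcond /=; apply: eq_bigr => c _.
  by rewrite -mulr_suml sum_octic_powers; case: (c \in C); rewrite ?mulr1 // mulr0n mulr0 mul0r.
ring.
Qed.

Lemma sum_octic_classes (h : F -> L) : h 0 = 0 ->
  \sum_g h g = \sum_(i < 8) \sum_(c in C) h (gamma ^+ i * c).
Proof.
move=> h0.
transitivity (\sum_g \sum_(i < 8) (g / gamma ^+ i \in C)%:R * h g).
  apply: eq_bigr => g _; rewrite -mulr_suml.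
  have [->|g0] := eqVneq g 0; first by rewrite h0 mulr0.
  have [n En] := octic_genP oct g0.
  have n8 : (n %% 8 < 8)%N by rewrite ltn_mod.
  have cE (i : 'I_8) : (g / gamma ^+ i \in C) = (i == Ordinal n8).
    have z0 : zeta ^+ i != 0.
      by rewrite -(octic_char_gen oct) (mult_char_neq0 hchi) // expf_neq0 ?(octic_gen_neq0 oct).
    rewrite octic_residueP (mult_charM hchi) (mult_charV _ hchi) En !(octic_char_gen oct).
    rewrite -(inj_eq (mulIf z0)) divfK // mul1r (eq_prim_root_expr (octic_zeta_prim oct)).
    by rewrite [(i %% 8)%N]modn_small // eq_sym -val_eqE.
  rewrite (bigD1 (Ordinal n8)) // cE eqxx big1 /= ?addr0 ?mul1r // => i /negbTE.
  by rewrite cE => ->.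
rewrite exchange_big /=; apply: eq_bigr => i _.
have gi0 : gamma ^+ i != 0 by rewrite expf_neq0 ?(octic_gen_neq0 oct).
rewrite (reindex_inj (mulfI gi0)) [RHS]big_mkcond /=; apply: eq_bigr => c _.
by rewrite [_ * c]mulrC mulfK // [c * _]mulrC; case: (c \in C); rewrite ?mul1r // mul0r.
Qed.

End OcticDifferences.

(** * The equations satisfied by the difference counts *)

Definition two_valued (h0 h1 h2 h3 : int) := exists l,
  [/\ (h0 = l \/ h0 = l + 1) /\ (h1 = l \/ h1 = l + 1),
      (h2 = l \/ h2 = l + 1) /\ (h3 = l \/ h3 = l + 1),
      [\/ h0 = l, h1 = l, h2 = l | h3 = l] &
      [\/ h0 = l + 1, h1 = l + 1, h2 = l + 1 | h3 = l + 1]].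

(** The equations of cyclotomy of order eight for odd f: h_i is the number of
    representations of gamma ^+ i as a difference, and (a, b), (x, y) are the
    coordinates of the Jacobi sums J(2, 4) and J(1, 4). *)
Definition octic_system (p a b x y h0 h1 h2 h3 : int) :=
  [/\ p = a ^+ 2 + b ^+ 2, p = x ^+ 2 + 2 * y ^+ 2,
      8 * (h0 - h1 + h2 - h3) = 7 + a + 2 * x &
      8 * (h0 - h2) = 7 - x /\ h1 = h3 \/
      8 * (h0 - h2) = 7 + 2 * a + x /\ 4 * (h1 - h3) = b].

Section OcticSystem.

Variables (F : finFieldType) (L : numFieldType) (f : nat) (zeta : L).
Variables (chi : F -> L) (gamma : F).
Hypothesis oct : octic_char f zeta chi gamma.

Let hchi := octic_mult oct.
Let z4 := octic_zeta oct.
Let z8 := octic_zeta8 oct.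
Let C := octic_residues F.
Let N g := difference_count (0 |: C) g.
Let C0 : #|C|%:R != 0 :> L := card_octic_residues_neq0 oct.

Lemma octic_class_fourier k : (0 < k)%N ->
  8 * \sum_(i < 8) (N (gamma ^+ i))%:R * zeta ^+ (i * k) =
  8 * (1 + chi (-1) ^+ k) + \sum_(m < 8) octic_jacobi chi m.+1 k.
Proof.
move=> k0; apply: (mulfI C0); rewrite -(octic_difference_fourier oct k0) mulrCA; congr (8 * _).
rewrite (sum_octic_classes oct) ?(mult_char0 hchi) ?expr0n ?eqn0Ngt ?k0 ?mulr0 //.
rewrite mulr_sumr; apply: eq_bigr => i _; rewrite (mulr_natl _ #|C|) -[LHS]sumr_const.
apply: eq_bigr => c cC; rewrite [_ * c]mulrC (difference_count_mul oct _ cC).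
have /eqP c1 : chi c == 1 by rewrite -(octic_residueP oct).
by rewrite (mult_charM hchi) c1 mul1r (octic_char_gen oct) -exprM.
Qed.

Lemma octic_class_mod m n : m = n %[mod 8] -> N (gamma ^+ m) = N (gamma ^+ n).
Proof.
have red k : N (gamma ^+ k) = N (gamma ^+ (k %% 8)).
  rewrite /N {1}(divn_eq k 8) exprD (difference_count_mul oct) // (octic_residueP oct).
  by rewrite (octic_char_gen oct) mulnC exprM z8 expr1n.
by move=> E; rewrite red E -red.
Qed.

Lemma octic_class_rep g : g != 0 -> exists2 i, (i < 8)%N & N g = N (gamma ^+ i).
Proof.
case/(octic_genP oct) => n ->; exists (n %% 8)%N; first by rewrite ltn_mod.
by apply: octic_class_mod; rewrite modn_mod.
Qed.

Lemma octic_char4P : chi 4 = 1 \/ chi 4 = -1.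
Proof.
by have /eqP := octic_char4_sqr oct; rewrite sqrf_eq1 => /orP[] /eqP; [left|right].
Qed.

Section OddIndex.

Hypothesis f_odd : odd f.

(** -1 = gamma ^+ (4 * f) lies in the class of gamma ^+ 4, and N (- g) = N g. *)
Lemma octic_class_half i : N (gamma ^+ (i + 4)) = N (gamma ^+ i).
Proof.
rewrite /N -[LHS]difference_countN -mulN1r -(octic_half oct) -exprD.
apply: octic_class_mod; rewrite addnCA -{2}(addn0 i); apply/eqP; rewrite eqn_modDl mod0n.
by rewrite -(odd_double_half f) f_odd; apply/eqP; lia.
Qed.

Lemma octic_odd_rep g : g != 0 -> exists2 i, (i < 4)%N & N g = N (gamma ^+ i).
Proof.
case/octic_class_rep => i i8 ->; have [i4|i4] := ltnP i 4; first by exists i.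
exists (i - 4)%N; first by lia.
by rewrite -[RHS]octic_class_half subnK.
Qed.

Let h i : int := N (gamma ^+ i).

(** The coefficients k = 4 and k = 2, the latter split into its coordinates on 1 and
    zeta ^+ 2; the two alternatives are chi 4 = 1 and chi 4 = -1. *)
Lemma octic_odd_system : exists a b x y : int,
  octic_system #|F| a b x y (h 0) (h 1) (h 2) (h 3).
Proof.
have [a [b [x [y [Eab Exy E24 E26 E17]]]]] := octic_jacobi_values oct.
have e1 : chi (-1) = -1 by rewrite (octic_charN1 oct) -signr_odd f_odd.
have hE i : (N (gamma ^+ i))%:R = (h i)%:~R :> L by [].
have h4 : h 4 = h 0 by rewrite /h (octic_class_half 0).
have h5 : h 5 = h 1 by rewrite /h (octic_class_half 1).
have h6 : h 6 = h 2 by rewrite /h (octic_class_half 2).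
have h7 : h 7 = h 3 by rewrite /h (octic_class_half 3).
exists a, b, x, y; split=> //.
  have := octic_class_fourier (isT : 0 < 4)%N.
  rewrite (sum_octic_jacobi4 oct) E26 E17 e1 !big_ord_recr big_ord0 /= !hE h4 h5 h6 h7 => E.
  have {}E : (8 * (2 * (h 0 - h 1 + h 2 - h 3)))%:~R = (2 * (7 + a + 2 * x))%:~R :> L.
    rewrite !(rmorphM, rmorphD, rmorphB) /=.
    transitivity (8 * (1 + (-1) ^+ 4) + (2 * (2 * x)%:~R + (2 * a)%:~R - 2) : L).
      by rewrite -E; ring: z4.
    by rewrite !rmorphM /=; ring.
  by move/intr_inj: E; lia.
have := octic_class_fourier (isT : 0 < 2)%N.
rewrite (sum_octic_jacobi2 oct) E24 E17 e1 !big_ord_recr big_ord0 /= !hE h4 h5 h6 h7.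
case: octic_char4P => -> E; [left|right].
  have /(gauss_int_inj oct)[] : (16 * (h 0 - h 2))%:~R + (16 * (h 1 - h 3))%:~R * zeta ^+ 2
     = (14 - 2 * x)%:~R + 0%:~R * zeta ^+ 2.
    rewrite !(rmorphM, rmorphD, rmorphB) /=.
    transitivity (8 * (1 + (-1) ^+ 2) + (2 * (1 + -1 * 1) * (a%:~R + b%:~R * zeta ^+ 2)
       + -1 * 1 * (2 * x)%:~R - 2) : L); first by rewrite -E; ring: z4.
    by rewrite !rmorphM /=; ring.
  by move=> E1 E2; split; lia.
have /(gauss_int_inj oct)[] : (16 * (h 0 - h 2))%:~R + (16 * (h 1 - h 3))%:~R * zeta ^+ 2
     = (14 + 4 * a + 2 * x)%:~R + (4 * b)%:~R * zeta ^+ 2.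
  rewrite !(rmorphM, rmorphD, rmorphB) /=.
  transitivity (8 * (1 + (-1) ^+ 2) + (2 * (1 + -1 * -1) * (a%:~R + b%:~R * zeta ^+ 2)
       + -1 * -1 * (2 * x)%:~R - 2) : L); first by rewrite -E; ring: z4.
  by rewrite !rmorphM /=; ring.
by move=> E1 E2; split; lia.
Qed.

End OddIndex.

Section EvenIndex.

Hypothesis f_even : ~~ odd f.
Variable lambda : nat.
Hypothesis two_values : forall g, g != 0 -> N g \in [:: lambda; lambda.+1].

Let e1 : chi (-1) = 1.
Proof. by rewrite (octic_charN1 oct) -signr_odd (negbTE f_even). Qed.

(** The odd one of the two values, minus the even one. *)
Let delta : L := (-1) ^+ lambda.

Let odd_count g : g != 0 -> odd (N g) = (chi g == chi 2).
Proof.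
move=> g0; have n2 := octic_two oct.
have DN x : (- x \in 0 |: C) = (x \in 0 |: C).
  by rewrite !in_setU1 oppr_eq0 !(octic_residueP oct) -mulN1r (mult_charM hchi) e1 mul1r.
have half x : (x + x == g) = (x == g / 2).
  by rewrite -mulr2n -[RHS](inj_eq (mulIf n2)) divfK // mulr_natr.
have c2 : chi 2 != 0 by rewrite (mult_char_neq0 hchi).
rewrite (odd_difference_count DN half) in_setU1 mulf_eq0 invr_eq0 (negbTE g0) (negbTE n2) /=.
rewrite (octic_residueP oct) (mult_charM hchi) (mult_charV _ hchi).
by rewrite -[RHS](inj_eq (mulIf (invr_neq0 c2))) mulfV.
Qed.

Let count_value g : g != 0 ->
  (N g)%:R = (lambda + odd lambda)%:R + delta * (chi g == chi 2)%:R :> L.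
Proof.
move=> g0; rewrite -odd_count // /delta -signr_odd.
have := two_values g0; rewrite !inE => /orP[] /eqP -> /=; case: (odd lambda) => /=;
  rewrite ?addn0 ?addn1 -?natr1 //=; ring.
Qed.

(** N is the even value plus delta on the coset of 2, so only that coset contributes. *)
Let even_fourier k : (0 < k)%N -> ~~ (8 %| k)%N ->
  8 * (delta * chi 2 ^+ k) = 16 + \sum_(m < 8) octic_jacobi chi m.+1 k.
Proof.
move=> k0 k8; apply: (mulfI C0).
have -> : 16 = 8 * (1 + chi (-1) ^+ k) :> L by rewrite e1 expr1n; ring.
rewrite -(octic_difference_fourier oct k0) mulrCA; congr (8 * _).
transitivity (\sum_g ((lambda + odd lambda)%:R * chi g ^+ k
    + delta * chi 2 ^+ k * (chi g == chi 2)%:R)).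
  rewrite big_split /= -mulr_sumr -mulr_sumr.
  have gk : chi gamma ^+ k != 1 by rewrite (octic_gen oct) (octic_zetaX_neq1 oct).
  rewrite (sum_mult_char (mult_charX k0 hchi) (octic_gen_neq0 oct) gk) mulr0 add0r mulrC.
  congr (_ * _); rewrite (reindex_inj (mulfI (octic_two oct))) -sum1_card natr_sum /=.
  rewrite big_mkcond /=; apply: eq_bigr => c _; rewrite (octic_residueP oct) (mult_charM hchi).
  have c2 : chi 2 != 0 by rewrite (mult_char_neq0 hchi) // (octic_two oct).
  by rewrite -{2}[chi 2]mulr1 (inj_eq (mulfI c2)); case: eqP.
apply: eq_bigr => g _; have [->|g0] := eqVneq g 0.
  rewrite (mult_char0 hchi) expr0n eqn0Ngt k0 !mulr0 add0r.
  by rewrite eq_sym (negbTE (mult_char_neq0 hchi (octic_two oct))) mulr0.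
rewrite -/(N g) count_value // mulrDl; congr (_ + _).
by case: eqP => [->|_]; rewrite ?mulr1 // !mulr0 mul0r.
Qed.

(** When chi 4 = 1 the coefficient k = 2 gives b = 0.  When chi 4 = -1 the coefficient
    k = 1 reads 8 * delta * chi 2 = 14 - 2 a - 2 b * zeta ^+ 2; as chi 2 squares to
    -1, squaring it gives a = 7 and b ^+ 2 = 16. *)
Lemma octic_even_two_valued_not_prime : ~~ prime #|F|.
Proof.
apply/negP => pF.
have [a [b [x [y [Eab Exy E24 E26 E17]]]]] := octic_jacobi_values oct.
have Ed : delta = ((-1) ^+ lambda : int)%:~R by rewrite rmorphXn rmorphN1.
case: octic_char4P => E4.
  have := even_fourier (isT : 0 < 2)%N isT.
  rewrite (sum_octic_jacobi2 oct) E24 E17 e1 -(octic_char4 oct) E4 Ed => E.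
  have /(gauss_int_inj oct)[_ b0] : (8 * (-1) ^+ lambda)%:~R + 0%:~R * zeta ^+ 2
     = (14 + 4 * a + 2 * x)%:~R + (4 * b)%:~R * zeta ^+ 2.
    transitivity (8 * (((-1) ^+ lambda : int)%:~R * 1) : L); first by rewrite rmorphM /=; ring.
    by rewrite E !(rmorphM, rmorphD) /=; ring.
  have {}b0 : b = 0 by lia.
  by move: Eab; rewrite b0 expr0n addr0; apply: prime_not_square.
have := even_fourier (isT : 0 < 1)%N isT.
rewrite (sum_octic_jacobi1 oct e1) E24 expr1 E4 => E.
have d2 : delta ^+ 2 = 1 by rewrite /delta -exprM mulnC exprM sqrrN !expr1n.
have /(gauss_int_inj oct)[] : (-64)%:~R + 0%:~R * zeta ^+ 2 =
    ((14 - 2 * a) ^+ 2 - 4 * b ^+ 2)%:~R + (- (4 * (14 - 2 * a) * b))%:~R * zeta ^+ 2.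
  transitivity ((8 * (delta * chi 2)) ^+ 2).
    by rewrite !exprMn d2 -(octic_char4 oct) E4; ring.
  by rewrite E !(rmorphM, rmorphD, rmorphB, rmorphXn, rmorphN) /=; ring: z4.
move=> E1 /esym/eqP; rewrite oppr_eq0 !mulf_eq0 /= => /orP[/eqP a7|/eqP b0].
  have {}a7 : a = 7 by lia.
  have : #|F|%:Z = 65 by rewrite Eab; move: E1; rewrite a7; lia.
  by move=> [F65]; move: pF; rewrite F65.
by move: E1; rewrite b0; have := sqr_ge0 (14 - 2 * a); lia.
Qed.

End EvenIndex.

End OcticSystem.

(** * Two consecutive values *)

Lemma two_valued_linear (a b x h0 h1 h2 h3 : int) : two_valued h0 h1 h2 h3 ->
  8 * (h0 - h1 + h2 - h3) = 7 + a + 2 * x ->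
  8 * (h0 - h2) = 7 - x /\ h1 = h3 \/ 8 * (h0 - h2) = 7 + 2 * a + x /\ 4 * (h1 - h3) = b ->
  [\/ x = -1 /\ (a = 3 \/ a = -13), x = 7 /\ (a = -5 \/ a = -37),
      x = 15 /\ (a = -29 \/ a = -45) |
      b = 0 \/ (a = -5 \/ a = 3) /\ (b = 4 \/ b = -4)].
Proof.
case=> l [[H0 H1] [H2 H3] Hl Hl1] E4 E2.
have ne : ~ (h0 = h1 /\ h2 = h1 /\ h3 = h1).
  by case=> E0 [E1 E3]; case: Hl => El; case: Hl1 => El1; clear -E0 E1 E3 El El1; lia.
case: E2 => [[E2 E13]|[E2 E13]]; case: H0 => H0; case: H1 => H1; case: H2 => H2; case: H3 => H3;
  first [ by case: ne; clear -H0 H1 H2 H3; lia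
        | clear -E4 E2 E13 H0 H1 H2 H3; first
          [ by exfalso; lia
          | by constructor 1; split; [lia|left; lia]
          | by constructor 1; split; [lia|right; lia]
          | by constructor 2; split; [lia|left; lia]
          | by constructor 2; split; [lia|right; lia]
          | by constructor 3; split; [lia|left; lia]
          | by constructor 3; split; [lia|right; lia]
          | by constructor 4; left; lia
          | by constructor 4; right; split; lia ]].
Qed.

(** Here y = 2 (2 k + 1), and odd squares are 1 modulo 8. *)
Lemma four_odd_sqr (y m : int) : y ^+ 2 = 4 * (2 * m + 1) ->
  exists k j, (2 * k + 1) ^+ 2 = 8 * j + 1 /\ 2 * m + 1 = 8 * j + 1.
Proof.
case/sqr_even=> z _ Ez; have [k [Ek|Ek]] := parityz z.
  have : 4 * k ^+ 2 = 2 * m + 1 by rewrite -Ez Ek; ring.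
  by lia.
by have [j Ej] := sqr_odd k; exists k, j; rewrite -Ej -Ez Ek.
Qed.

(** For each x allowed by [two_valued_linear], p = 9 modulo 16 and
    p = x ^+ 2 + 2 y ^+ 2 make y twice an odd number, so p is known modulo 64; then
    b ^+ 2 = p - a ^+ 2 is 32 modulo 64 unless (x, a) is (-1, 3) or (15, -45), and
    the last pair makes 9 divide p.  The remaining alternatives b = 0 and
    b ^+ 2 = 16 make p a square or 41. *)
Lemma two_valued_octic_system (p : nat) (f a b x y h0 h1 h2 h3 : int) :
  prime p -> p%:Z = 8 * (2 * f + 1) + 1 -> octic_system p a b x y h0 h1 h2 h3 ->
  two_valued h0 h1 h2 h3 ->
  p = 41%N \/ exists t' u : int,
     [/\ ~~ (2 %| t')%Z, ~~ (2 %| u)%Z, p%:Z = 8 * t' ^+ 2 + 1 & p%:Z = 64 * u ^+ 2 + 9].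
Proof.
move=> pp Ep [Eab Exy E4 E2] H2v; have := two_valued_linear H2v E4 E2.
(* x ^+ 2 is 1, 49 or 225, that is c = 0, 3 or 14 *)
have {E4 E2 H2v} form c : x ^+ 2 = 16 * c + 1 ->
    exists k j, (2 * k + 1) ^+ 2 = 8 * j + 1 /\ p%:Z = 64 * j + 9 + 16 * c.
  move=> Ex; have /four_odd_sqr[k [j [Ek Ej]]] : y ^+ 2 = 4 * (2 * (f - c) + 1).
    by move: Exy; rewrite Ep Ex; move: (y ^+ 2) => y2; clear; lia.
  by exists k, j; split=> //; rewrite Ep; move: Ej; clear; lia.
case=> [[Ex]|[Ex]|[Ex]|].
- case: (form 0); first by rewrite Ex.
  move=> k [j [Ek Epj]] [] Ea; move: Eab; rewrite Ea Epj => Eb; last first.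
    by case: (@sqr_mod64 b (j - 3)); move: Eb; clear; lia.
  have {}Eb : b ^+ 2 = 4 * (16 * j) by move: Eb; clear; lia.
  have [b1 _ Eb1] := sqr_even Eb.
  have {}Eb1 : b1 ^+ 2 = 4 * (4 * j) by move: Eb1; clear; lia.
  have [b2 _ /sqr_even[u _ Eu]] := sqr_even Eb1.
  right; exists (2 * k + 1), u; split.
  + by clear; lia.
  + apply/negP => /dvdzP[w Ew]; apply: (@pell_odd p (2 * k + 1) w pp).
      by rewrite Epj Ek; clear; lia.
    by rewrite [2 * w]mulrC -Ew Epj Eu; clear; lia.
  + by rewrite Ek; clear; lia.
  + by rewrite Eu; clear; lia.
- case: (form 3); first by rewrite Ex.
  move=> k [j [Ek Epj]] [] Ea; move: Eab; rewrite Ea Epj => Eb.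
    by case: (@sqr_mod64 b j); move: Eb; clear; lia.
  by case: (@sqr_mod64 b (j - 21)); move: Eb; clear; lia.
- case: (form 14); first by rewrite Ex.
  move=> k [j [Ek Epj]] [] Ea; move: Eab; rewrite Ea => Eb.
    by case: (@sqr_mod64 b (j - 10)); move: Eb; rewrite Epj; clear; lia.
  have : b ^+ 2 + (2 * k + 1) ^+ 2 = 3 * (24 * j - 597).
    by rewrite Ek; move: Eb; rewrite Epj; clear; lia.
  case/sqr_add_mul3=> -[b' Eb'] _; case: (@prime_not_mul9 p (225 + b' ^+ 2) pp).
  by rewrite Eb Eb'; clear; ring.
case=> [b0|[Ea Eb]].
  by case: (@prime_not_square p a pp); rewrite Eab b0 expr0n addr0.
have {Eb} Eb : b ^+ 2 = 16 by case: Eb => ->.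
move: Eab; rewrite Eb; case: Ea => -> Ep'; first by left; move: Ep'; clear; lia.
have p25 : p = 25 by move: Ep'; clear; lia.
by move: pp; rewrite p25.
Qed.

(** The equation for h0 - h1 + h2 - h3 makes a odd, so b is even and uniqueness for
    the form a ^+ 2 + 4 b ^+ 2 applies. *)
Lemma octic_system_sqr_a (p : nat) (a b x y h0 h1 h2 h3 c d : int) :
  prime p -> odd p -> octic_system p a b x y h0 h1 h2 h3 ->
  p%:Z = c ^+ 2 + 4 * d ^+ 2 -> a ^+ 2 = c ^+ 2.
Proof.
move=> pp op [Eab _ E4 _] Ecd.
have [k Ek] : exists k, a = 2 * k + 1 by exists (4 * (h0 - h1 + h2 - h3) - 4 - x); lia.
have [b' [Eb|Eb]] := parityz b.
  apply: (@quadratic_form_sqr_uniq p 4 a b' c d pp isT) => //.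
  by rewrite Eab Eb; clear; ring.
have [q Eq] : exists q : nat, p = q.*2.+1 by exists p./2; rewrite -[LHS]odd_double_half op.
have : q.*2.+1%:Z = 2 * (2 * k ^+ 2 + 2 * k + 2 * b' ^+ 2 + 2 * b' + 1).
  by rewrite -Eq Eab Ek Eb; clear; ring.
by clear; move: (_ + 1) => v; lia.
Qed.

(** 41 = 5 ^+ 2 + 4 ^+ 2 = 3 ^+ 2 + 2 * 4 ^+ 2; integrality leaves only a = -5, x = 3 and
    the alternative with 4 (h1 - h3) = b. *)
Lemma octic_system_41 (a b x y h0 h1 h2 h3 : int) :
  octic_system 41 a b x y h0 h1 h2 h3 -> two_valued h0 h1 h2 h3.
Proof.
move=> S; have a5 : a ^+ 2 = 5 ^+ 2 by apply: (@octic_system_sqr_a 41 _ _ _ _ _ _ _ _ _ 2 _ _ S).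
case: S => Eab Exy E4 E2.
have x3 : x ^+ 2 = 3 ^+ 2 by apply: (@quadratic_form_sqr_uniq 41 2 x y 3 4).
have b4 : b ^+ 2 = 4 ^+ 2 by move: Eab; rewrite a5; clear; lia.
have sq n c : n ^+ 2 = c ^+ 2 -> n = c \/ n = - c :> int.
  by move/eqP; rewrite eqf_sqr => /orP[] /eqP; [left|right].
have {a5 x3 b4} [E0 [E13 Es]] : h0 = h2 /\ (h1 = h3 + 1 \/ h3 = h1 + 1) /\ h0 - h1 + h2 - h3 = 1.
  by move: (sq _ _ a5) (sq _ _ x3) (sq _ _ b4) E4 E2; clear; lia.
case: E13 => E13; [exists h3|exists h1]; (split; first by lia); try by lia.
- by constructor 4.
- by constructor 1; lia.
- by constructor 2.
- by constructor 1; lia.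
Qed.

(** p = 3 ^+ 2 + (8 u) ^+ 2 = 1 + 2 (2 t) ^+ 2; integrality leaves only a = 3, x = -1 and
    the alternative with h1 = h3. *)
Lemma octic_system_pell (p : nat) (a b x y h0 h1 h2 h3 t u : int) :
  prime p -> p%:Z = 8 * t ^+ 2 + 1 -> p%:Z = 64 * u ^+ 2 + 9 ->
  octic_system p a b x y h0 h1 h2 h3 -> two_valued h0 h1 h2 h3.
Proof.
move=> pp Et Eu S; have op : odd p.
  by move: Et; clear; move: (t ^+ 2) => v; lia.
have a3 : a ^+ 2 = 3 ^+ 2.
  apply: (@octic_system_sqr_a p _ _ _ _ _ _ _ _ _ (4 * u) pp op S).
  by rewrite Eu; clear; ring.
case: S => Eab Exy E4 E2.
have x1 : x ^+ 2 = 1 ^+ 2.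
  apply: (@quadratic_form_sqr_uniq p 2 x y 1 (2 * t) pp) => //.
  by rewrite Et; clear; ring.
have sq n c : n ^+ 2 = c ^+ 2 -> n = c \/ n = - c :> int.
  by move/eqP; rewrite eqf_sqr => /orP[] /eqP; [left|right].
have [E12 [E23 E0]] : h1 = h2 /\ h2 = h3 /\ h0 = h1 + 1.
  by move: (sq _ _ a3) (sq _ _ x1) E4 E2; clear; lia.
by clear -E12 E23 E0; exists h1; split; [lia|lia|constructor 2|constructor 1].
Qed.

(** * The characterization *)

Lemma prim8_root_expr4 (L : numFieldType) (zeta : L) : 8.-primitive_root zeta -> zeta ^+ 4 = -1.
Proof.
move=> zP; have : (zeta ^+ 4) ^+ 2 == 1 by rewrite -exprM (prim_expr_order zP).
by rewrite sqrf_eq1 => /orP[|/eqP //]; rewrite -(prim_order_dvd zP).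
Qed.

Lemma almost_difference_set_octic_odd (p f : nat) : prime p -> p = (8 * f).+1 -> odd f ->
  exists a b x y h0 h1 h2 h3 : int, octic_system p a b x y h0 h1 h2 h3 /\
  ((exists k lambda t : nat, (0 < t < p - 1)%N /\
      almost_difference_set p k lambda t (0 |: octic_residues 'F_p)) <->
    two_valued h0 h1 h2 h3).
Proof.
move=> pp Ep f_odd; have cF := card_Fp pp.
have [zeta zP] := C_prim_root_exists (isT : 0 < 8)%N.
have [chi [gamma oct]] := octic_char_exists (etrans cF Ep) (prim8_root_expr4 zP).
have := octic_odd_system oct f_odd; rewrite cF => -[a [b [x [y S]]]].
set N := difference_count (0 |: octic_residues 'F_p) in S.
exists a, b, x, y, (N (gamma ^+ 0)), (N (gamma ^+ 1)), (N (gamma ^+ 2)), (N (gamma ^+ 3)).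
split; first exact: S.
have g0 i : gamma ^+ i != 0 by rewrite expf_neq0 ?(octic_gen_neq0 oct).
have rep := octic_odd_rep oct f_odd; rewrite -/N in rep.
rewrite (almost_difference_setP _ cF) -/N; split.
  case=> l [two [g g_neq0 Eg] [g' g'_neq0 Eg']]; exists l%:Z.
  have tw i : (N (gamma ^+ i))%:Z = l%:Z \/ (N (gamma ^+ i))%:Z = l%:Z + 1.
    by have := two _ (g0 i); rewrite !inE => /orP[] /eqP ->; [left|right; lia].
  split=> //.
    move: Eg; have [i i4 ->] := rep g g_neq0; case: i i4 => [|[|[|[|//]]]] _ E;
      [constructor 1|constructor 2|constructor 3|constructor 4]; by rewrite E.
  move: Eg'; have [i i4 ->] := rep g' g'_neq0; case: i i4 => [|[|[|[|//]]]] _ E;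
      [constructor 1|constructor 2|constructor 3|constructor 4]; rewrite E; lia.
case=> l [[H0 H1] [H2 H3] Hl Hl1].
have [n En] : exists n : nat, l = n.
  by case: Hl => <-; [exists (N (gamma ^+ 0))|exists (N (gamma ^+ 1))|exists (N (gamma ^+ 2))|exists (N (gamma ^+ 3))].
rewrite {l}En in H0 H1 H2 H3 Hl Hl1.
exists n; split.
- move=> g g_neq0; rewrite !inE; have [i i4 ->] := rep g g_neq0.
  by case: i i4 => [|[|[|[|//]]]] _; lia.
- by case: Hl => E; [exists (gamma ^+ 0)|exists (gamma ^+ 1)|exists (gamma ^+ 2)|exists (gamma ^+ 3)] => //; lia.
- by case: Hl1 => E; [exists (gamma ^+ 0)|exists (gamma ^+ 1)|exists (gamma ^+ 2)|exists (gamma ^+ 3)] => //; lia.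
Qed.

Local Close Scope ring_scope.

Theorem theorem13 (p : nat) (p_prime : prime p) (p_mod8 : p = 1 %[mod 8]) :
  (exists k lambda t : nat,
      (0 < t < p - 1)%N /\
      almost_difference_set p k lambda t (0%R |: octic_residues 'F_p))
  <->
  (p = 41 \/
   exists t' u : int,
     [/\ ~~ (2 %| t')%Z, ~~ (2 %| u)%Z,
         (p%:Z = 8 * t' ^+ 2 + 1)%R
       & (p%:Z = 64 * u ^+ 2 + 9)%R]).
Proof.
pose f := (p %/ 8)%N.
have Ep : p = (8 * f).+1 by rewrite [LHS](divn_eq p 8) p_mod8 mulnC addn1.
have cF := card_Fp p_prime.
have [f_odd|f_even] := boolP (odd f).
  have [a [b [x [y [h0 [h1 [h2 [h3 [S ->]]]]]]]]] :=
    almost_difference_set_octic_odd p_prime Ep f_odd.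
  split=> [|[p41|[t [u [_ _ Et Eu]]]]].
  - apply: (two_valued_octic_system (f := f./2%:Z) p_prime) S.
    by rewrite {1}Ep -{1}(odd_double_half f) f_odd; lia.
  - by move: S; rewrite p41; apply: octic_system_41.
  - exact: octic_system_pell p_prime Et Eu S.
split.
  case/(almost_difference_setP _ cF) => l [two _ _]; exfalso.
  have [zeta zP] := C_prim_root_exists (isT : 0 < 8)%N.
  have [chi [gamma oct]] := octic_char_exists (etrans cF Ep) (prim8_root_expr4 zP).
  by have := octic_even_two_valued_not_prime oct f_even two; rewrite cF p_prime.
case=> [p41|[t [u [t_odd _ Et _]]]]; first by move: f_even; rewrite /f p41.
exfalso; move: f_even; have -> : f = (`|t| ^ 2)%N.
  by rewrite -abszX; move: Et; rewrite Ep; have := sqr_ge0 t; clear; move: (t ^+ 2)%R => v; lia.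
by rewrite oddX /=; move: t_odd; clear; lia.
Qed.
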